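(* Let $\mathcal{S}$ be a quasi-Eberlein family of subsets of a set $\Gamma$, with decomposition $\mathcal{S}=\bigcup_{n\ge1}\mathcal{S}_n$ as in the definition, and let $\mathcal{S}E=\{\tfrac1n\chi_s: n\in\mathbb{N},\ s\in\mathcal{S}_n\}\subseteq[0,1]^{\Gamma}$ be its Eberleinization. For $\gamma\in\Gamma$ let $e_\gamma\in C(\mathcal{S}E)$ be the restriction to $\mathcal{S}E$ of the coordinate projection $\pi_\gamma:[0,1]^{\Gamma}\to[0,1]$, and let $X$ be the closed linear span of $\{e_\gamma\}_{\gamma\in\Gamma}$ in $C(\mathcal{S}E)$. Then $X$ is a subspace of a weakly compactly generated Banach space but $X$ is not itself weakly compactly generated.
   Context: A pointwise closed family $\mathcal{S}$ of countable subsets of $\Gamma$ (closed when identified with $\{\chi_s\}\subseteq\{0,1\}^\Gamma$) is quasi-Eberlein if: (i) all singletons $\{\gamma\}$, $\gamma\in\Gamma$, belong to $\mathcal{S}$, and each $s\in\mathcal{S}$ is an increasing union of finite sets belonging to $\mathcal{S}$; (ii) $\mathcal{S}=\bigcup_{n=1}^\infty\mathcal{S}_n$ where each $\mathcal{S}_n$ is an Eberlein compact set (in the pointwise topology) and all singletons of $\Gamma$ belong to $\mathcal{S}_1$; (iii) for every partition $(\Gamma_d)_{d\in D}$ of $\Gamma$ into pairwise disjoint countable sets and every partition $(\Gamma_n)_{n\in\mathbb{N}}$ of $\Gamma$ there exist $s\in\mathcal{S}$ and $n_0\in\mathbb{N}$ such that $s\cap\Gamma_{n_0}$ is infinite and $\#(s\cap\Gamma_d)\le1$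 for all $d\in D$. A compact space is Eberlein compact if it is homeomorphic to a weakly compact subset of a Banach space. A Banach space is weakly compactly generated (W.C.G.) if it contains a weakly compact set with dense linear span. *)

(* Defs.v *)
From HB Require Import structures.
From mathcomp Require Import all_boot all_order all_algebra.
From mathcomp Require Import all_classical all_reals.
From mathcomp Require Import topology normedtype numfun.
From mathcomp Require Import Rstruct.
Set Implicit Arguments. Unset Strict Implicit. Unset Printing Implicit Defensive.
Import Order.TTheory GRing.Theory Num.Theory.
Local Open Scope classical_set_scope.
Local Open Scope ring_scope.

Notation R := Rdefinitions.R.

Notation FS G := ((G -> R) -> R^o).

(* Both the pointwise (product) topology on R^Gamma (F = coordinate
   projections) and the weak topology of a normed space (F = continuous
   linear functionals) are initial topologies of this kind.  All notions are
   relative to an ambient subset Y (subspace topology). *)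
Section InitialTop.
Variable A : Type.

Definition Fopen_in (F : set (A -> R)) (Y U : set A) : Prop :=
  forall x, Y x -> U x ->
    exists n (fs : 'I_n -> A -> R), (forall i, F (fs i)) /\
    exists e : R, 0 < e /\
      forall y, Y y -> (forall i, `|fs i y - fs i x| < e) -> U y.

Definition Fcompact_in (F : set (A -> R)) (Y K : set A) : Prop :=
  K `<=` Y /\
  forall C : set (set A), (forall U, C U -> Fopen_in F Y U) ->
    K `<=` \bigcup_(U in C) U ->
    exists n (g : 'I_n -> set A), (forall i, C (g i)) /\ K `<=` \bigcup_i g i.

Definition Fclosed_in (F : set (A -> R)) (Y K : set A) : Prop :=
  K `<=` Y /\
  forall x, Y x ->
    (forall n (fs : 'I_n -> A -> R) (e : R), (forall i, F (fs i)) -> 0 < e ->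
       exists y, Y y /\ K y /\ forall i, `|fs i y - fs i x| < e) -> K x.
End InitialTop.

(* h : A -> B is continuous from the subspace Y of (A, F) to (B, G)
   (continuity into an initial topology = continuity of each g \o h) *)
Definition Fcont (A B : Type) (F : set (A -> R)) (Y : set A)
    (G : set (B -> R)) (h : A -> B) : Prop :=
  forall x, Y x -> forall g, G g -> forall e : R, 0 < e ->
    exists n (fs : 'I_n -> A -> R), (forall i, F (fs i)) /\
    exists d : R, 0 < d /\
      forall y, Y y -> (forall i, `|fs i y - fs i x| < d) ->
        `|g (h y) - g (h x)| < e.

(* V a real vector space, N a norm on the linear subspace Y of V. *)
Section Weak.
Variable V : lmodType R.

Definition lin_on (W : lmodType R) (Y : set V) (T : V -> W) : Prop :=
  forall (a : R) x y, Y x -> Y y -> T (a *: x + y) = a *: T x + T y.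

Definition dual_on (N : V -> R) (Y : set V) : set (V -> R) :=
  [set f | lin_on (W := R^o) Y f /\
           exists C : R, forall y, Y y -> `|f y| <= C * N y].

Definition weakly_compact_in (N : V -> R) (Y K : set V) : Prop :=
  Fcompact_in (dual_on N Y) Y K.

Definition span_dense_in (N : V -> R) (Y K : set V) : Prop :=
  forall y, Y y -> forall e : R, 0 < e ->
    exists n (c : 'I_n -> R) (k : 'I_n -> V), (forall i, K (k i)) /\
      N (y - \sum_(i < n) c i *: k i) < e.

Definition WCG_in (N : V -> R) (Y : set V) : Prop :=
  exists K : set V, weakly_compact_in N Y K /\ span_dense_in N Y K.
End Weak.

Definition WCG (E : completeNormedModType R) : Prop :=
  WCG_in (fun x : E => `|x|) setT.

Definition coords (G : Type) : set (FS G) :=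
  range (fun g : G => fun x : G -> R => x g).

Definition chi (G : Type) (s : set G) : G -> R := \1_s.

Definition Eberlein_compact (G : Type) (K : set (G -> R)) : Prop :=
  exists (E : completeNormedModType R) (W : set E)
         (h : (G -> R) -> E) (k : E -> G -> R),
    weakly_compact_in (fun x : E => `|x|) setT W /\
    (forall x, K x -> W (h x) /\ k (h x) = x) /\
    (forall w, W w -> K (k w) /\ h (k w) = w) /\
    Fcont (@coords G) K (dual_on (fun x : E => `|x|) setT) h /\
    Fcont (dual_on (fun x : E => `|x|) setT) W (@coords G) k.

(* Sn n stands for the paper's S_{n+1} (paper indexes from 1). *)
Definition quasi_Eberlein (G : Type) (S : set (set G))
    (Sn : nat -> set (set G)) : Prop :=
  (forall s, S s -> countable s) /\
  Fclosed_in (@coords G) setT [set chi s | s in S] /\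
  (forall g : G, S [set g]) /\
  (forall s, S s -> exists t : nat -> set G,
     (forall m, finite_set (t m) /\ S (t m) /\ t m `<=` t m.+1) /\
     s = \bigcup_m t m) /\
  S = \bigcup_n Sn n /\
  (forall n, Eberlein_compact [set chi s | s in Sn n]) /\
  (forall g : G, Sn 0%N [set g]) /\
  (forall P : set (set G),
     (forall D, P D -> countable D) ->
     (forall D D', P D -> P D' -> D <> D' -> D `&` D' = set0) ->
     (forall g, exists D, P D /\ D g) ->
   forall Gn : nat -> set G,
     (forall m n, m <> n -> Gn m `&` Gn n = set0) ->
     (forall g, exists n, Gn n g) ->
   exists s n0, S s /\ infinite_set (s `&` Gn n0) /\
     forall D, P D -> forall x y, (s `&` D) x -> (s `&` D) y -> x = y).

Definition Eberleinization (G : Type) (Sn : nat -> set (set G)) : set (G -> R) :=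
  [set x | exists n s, Sn n s /\ x = (fun g => n.+1%:R^-1 * chi s g)].

(* The ambient space: real functions on R^Gamma; C(SE) is represented by the
   functions continuous on SE and vanishing off SE, with the sup norm on SE. *)
Definition supnorm (G : Type) (K : set (G -> R)) (f : FS G) : R :=
  sup [set `|f x| | x in K].

Definition CK (G : Type) (K : set (G -> R)) : set (FS G) :=
  [set f | (forall x, ~ K x -> f x = 0) /\
           Fcont (@coords G) K [set id] f].

Definition e_coord (G : Type) (K : set (G -> R)) (g : G) : FS G :=
  fun x => \1_K x * x g.

Definition Xspace (G : Type) (K : set (G -> R)) : set (FS G) :=
  [set f | CK K f /\
     forall e : R, 0 < e -> exists n (c : 'I_n -> R) (gs : 'I_n -> G),
       supnorm K (f - \sum_(i < n) c i *: e_coord K (gs i)) < e].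

(* Main.v *)
Require Import Defs.
From HB Require Import structures.
From mathcomp Require Import all_boot all_order all_algebra.
From mathcomp Require Import all_classical all_reals.
From mathcomp Require Import topology normedtype numfun.
From mathcomp Require Import Rstruct wochoice ring lra.
Set Implicit Arguments. Unset Strict Implicit. Unset Printing Implicit Defensive.
Import Order.TTheory GRing.Theory Num.Theory.
Local Open Scope classical_set_scope.
Local Open Scope ring_scope.

(** Let Q be a compact set of countably supported points of R^Gamma and H a
pointwise compact set of continuous functions on Q.  Closing off subsets of
Gamma under countably many finitary choices yields sets A for which the
restriction r_A : x |-> x 1_A maps Q into itself and f \o r_A belongs to H for
every f in H.  Along a well-ordered increasing chain (A_b) of such sets, with
A_<b the union of the earlier ones, compactness of H forces
sup_H |f (r_{A_b} x) - f (r_{A_<b} x)| > e to hold for only finitely many b, and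
every closed set is built up from countable ones by such chains.

Applied to S_n and the dual unit ball of a Banach space in which S_n is weakly
compact, this gives a colouring of Gamma by the integers for which each s in
S_n contains finitely many points of each colour.  By Ptak's convex combination
argument each functional is then small at all but finitely many coordinate
functions of a given colour, so the c_0-sum of the spans of the coordinate
functions over S_n is weakly compactly generated; it contains X isometrically
because of the factor 1/n in the Eberleinization.

Applied to SE and a weakly compact generating set K of X, it gives a partition
of Gamma into countable pieces D and operators T_D sending e_g to e_g or 0
according to whether g is in D, such that for each x in SE only finitely many D
have sup_K |T_D k (x)| above a fixed multiple of 2^depth(D).  If s meets each
piece in at most one point, then T_D k (chi_s / n) = k (chi_{g}) / n for g in
s and D.  Choosing k_g in K not vanishing at chi_{g} and colouring g by the size
of k_g (chi_{g}), such an s has finitely many points of each colour, against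
(iii). *)

(** * Transfinite induction over closed sets *)

Lemma countable_range_sub (C : countType) (T : Type) (e : C -> T) (A : set T) :
  A `<=` range e -> countable A.
Proof.
move=> Ae; apply: (@sub_countable _ _ A (range e)); first exact: subset_card_le.
exact: card_le_trans (card_image_le _ _) (countableP _).
Qed.

Lemma countable_enum (T : Type) (A : set T) (x0 : T) :
  countable A -> exists e : nat -> T, forall x, A x -> exists n, e n = x.
Proof.
move=> /countable_injP[f fI].
have /choice[e He] : forall n, exists x, (exists2 y, A y & f y = n) -> A x /\ f x = n.
  move=> n; have [[y Ay fy]|N] := pselect (exists2 y, A y & f y = n).
    by exists y.
  by exists x0.
exists e => x Ax; exists (f x).
have [Ae fe] : A (e (f x)) /\ f (e (f x)) = f x by apply: He; exists x.
by apply: fI; rewrite ?inE.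
Qed.

Lemma well_ordering (T : Type) : exists lt : T -> T -> Prop,
  [/\ well_founded lt, (forall x y z, lt x y -> lt y z -> lt x z) &
      forall x y, [\/ lt x y, x = y | lt y x]].
Proof.
have [r wo] := well_ordering_principle {classic T}.
have min (A : set T) : A !=set0 -> exists2 z, A z & forall x, A x -> r z x.
  move=> [x Ax].
  have : nonempty [pred z : {classic T} | `[< A z >]].
    by exists x; apply/asboolP.
  move=> /wo[z [[/asboolP Az lb] _]]; exists z => // y Ay.
  by apply: lb; apply/asboolP.
have total x y : r x y \/ r y x.
  have [z] := min [set x; y] (ex_intro _ x (or_introl erefl)).
  by move=> [->|->] zP; [left; apply: zP; right|right; apply: zP; left].
(* Both points are least in the pair, and the well-ordering principle makes least elements
   unique. *)
have anti x y : r x y -> r y x -> x = y.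
  move=> xy yx.
  have rr z : r z z by case: (total z z).
  have : nonempty [pred z : {classic T} | (z == x) || (z == y)].
    by exists x; rewrite inE eqxx.
  move=> /wo[z [_ u]].
  transitivity z; first apply/esym; apply: u; split.
  - by rewrite inE eqxx.
  - by move=> w; rewrite inE => /orP[/eqP->|/eqP->].
  - by rewrite inE eqxx orbT.
  - by move=> w; rewrite inE => /orP[/eqP->|/eqP->].
have trans x y z : r x y -> r y z -> r x z.
  move=> xy yz.
  have [w] := min [set x; y; z] (ex_intro _ x (or_introl (or_introl erefl))).
  move=> [[->|->]|->] wP.
  - by apply: wP; right.
  - by rewrite -(@anti y x) //; apply: wP; left; left.
  - suff -> : z = y by [].
    by apply: anti => //; apply: wP; left; right.
exists (fun x y => r x y /\ x <> y); split.
- move=> x; apply: contrapT => Nx.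
  have [|z Nz zm] := min [set x | ~ Acc (fun x y => r x y /\ x <> y) x].
    by exists x.
  apply: Nz; constructor => y [yz yNz]; apply: contrapT => Ny.
  by apply: yNz; apply: anti => //; apply: zm.
- move=> x y z [xy nxy] [yz nyz]; split; first exact: trans yz.
  by move=> xz; apply: nxy; apply: anti => //; rewrite xz.
- move=> x y; have [->|ne] := pselect (x = y); first by constructor 2.
  by have [xy|yx] := total x y; [constructor 1|constructor 3; split=> // /esym].
Qed.

Lemma countable_setU (T : Type) (A B : set T) :
  countable A -> countable B -> countable (A `|` B).
Proof.
move=> cA cB; rewrite -bigcup2E; apply: bigcup_countable => //.
by move=> [|[|i]] _ //=; exact: countable0.
Qed.

Section Closure.
Variables (V : Type) (c : seq V -> set V).
Hypothesis c_countable : forall l, countable (c l).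

Definition closed_under (M : set V) :=
  forall l, (forall v, List.In v l -> M v) -> c l `<=` M.

Inductive cl (B : set V) : set V :=
| cl_base v : B v -> cl B v
| cl_step l v : (forall w, List.In w l -> cl B w) -> c l v -> cl B v.

Lemma cl_closed B : closed_under (cl B).
Proof. by move=> l lB v lv; apply: cl_step lv. Qed.

Lemma cl_min B M : closed_under M -> B `<=` M -> cl B `<=` M.
Proof.
by move=> cM BM v; elim=> [{}v /BM//|l {}v _ IH lv]; apply: (cM l).
Qed.

Lemma cl_mono B B' : B `<=` B' -> cl B `<=` cl B'.
Proof.
by move=> BB'; apply: cl_min; [exact: cl_closed|move=> v /BB'; exact: cl_base].
Qed.

Lemma countable_lists (A : set V) :
  countable A -> countable [set l | forall v, List.In v l -> A v].
Proof.
move=> cA; have [v0|V0] := pselect (exists v : V, True); last first.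
  apply: (@countable_range_sub unit _ (fun=> [::])) => -[|v l _].
    by exists tt.
  by case: V0; exists v.
have [x0 _] := v0.
have [e eP] := countable_enum x0 cA.
apply: (@countable_range_sub (seq nat) _ (map e)) => l.
elim: l => [_|v l IH lA]; first by exists [::].
have [|k _ kl] := IH; first by move=> w wl; apply: lA; right.
have [|n nv] := eP v; first by apply: lA; left.
by exists (n :: k) => //=; rewrite nv kl.
Qed.

(** Rules are finitary, so [omega] rounds suffice: the premises of a rule already lie in one round
    [iter n S B], and its conclusions lie in the next. *)
Lemma cl_countable B : countable B -> countable (cl B).
Proof.
move=> cB.
pose S (A : set V) := A `|` \bigcup_(l in [set l | forall v, List.In v l -> A v]) c l.
have cS n : countable (iter n S B).
  elim: n => //= n IH.
  apply: countable_setU => //; apply: bigcup_countable => //.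
  exact: countable_lists.
have mS m n : (m <= n)%N -> iter m S B `<=` iter n S B.
  move=> /subnK <-; elim: (n - m)%N => // k IH v /IH vk.
  by rewrite addSn /=; left.
apply: (@sub_countable _ _ _ (\bigcup_n iter n S B)); last first.
  by apply: bigcup_countable => //; exact: countableP.
apply: subset_card_le; apply: cl_min => [l lS v lv|v Bv]; last by exists 0%N.
have [n nP] : exists n, forall v, List.In v l -> iter n S B v.
  elim: l lS {v lv} => [_|w l IH lS]; first by exists 0%N.
  have [|n nP] := IH; first by move=> v vl; apply: lS; right.
  have [|m _ mP] := lS w; first by left.
  exists (maxn m n) => v /= [<-|vl].
    by apply: mS mP; rewrite leq_maxl.
  by apply: mS (nP _ vl); rewrite leq_maxr.
by exists n.+1 => //=; right; exists l.
Qed.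

Variable lt : V -> V -> Prop.
Hypotheses (lt_wf : well_founded lt)
  (lt_trans : forall x y z, lt x y -> lt y z -> lt x z)
  (lt_total : forall x y, [\/ lt x y, x = y | lt y x]).

(** The finitely many premises of a rule all lie in one member of the chain. Nonemptiness of [I]
    supplies a member for rules without premises. *)
Lemma closed_chain (I : set V) (B : V -> set V) :
  (forall y, I y -> closed_under (B y)) ->
  (forall y z, I y -> I z -> lt y z -> B y `<=` B z) ->
  I !=set0 -> closed_under (\bigcup_(y in I) B y).
Proof.
move=> cB mB [i0 Ii0] l lB v lv.
have [y Iy yP] : exists2 y, I y & forall v, List.In v l -> B y v.
  elim: l lB {v lv} => [_|w l IH lS]; first by exists i0.
  have [|n In nP] := IH; first by move=> v vl; apply: lS; right.
  have [|m Im mP] := lS w; first by left.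
  have [mn|mn|nm] := lt_total m n.
  - by exists n => // v /= [<-|vl]; [apply: (mB m n)|apply: nP].
  - by exists n => // v /= [<-|vl]; [rewrite -mn|apply: nP].
  - by exists m => // v /= [<-//|vl]; apply: (mB n m) => //; apply: nP.
by exists y => //; apply: (cB y Iy l).
Qed.

Variable Good : set V -> Prop.
Hypothesis Good_countable : forall M, closed_under M -> countable M -> Good M.
Hypothesis Good_chain : forall (I : set V) (B : V -> set V),
  (forall y, I y -> closed_under (B y) /\ Good (B y)) ->
  (forall y z, I y -> I z -> lt y z -> B y `<=` B z) ->
  Good (\bigcup_(y in I) B y).

(* Allowing a countable set C of extra generators makes one chain argument
   cover the zero, successor and limit stages. *)
Lemma Good_segment x C : countable C -> Good (cl ([set z | lt z x] `|` C)).
Proof.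
elim/(well_founded_ind lt_wf): x C => x IH C cC.
pose B y := cl ([set z | lt z y \/ z = y] `|` C).
have mB y z : lt y z -> B y `<=` B z.
  move=> yz; apply: cl_mono => w [[wy|->]|Cw]; last by right.
    by left; left; apply: lt_trans yz.
  by left; left.
have [[y0 y0x]|N] := pselect (exists y, lt y x); last first.
  apply: Good_countable; first exact: cl_closed.
  apply: cl_countable; apply: sub_countable cC; apply: subset_card_le => z [zx|//].
  by case: N; exists z.
suff -> : cl ([set z | lt z x] `|` C) = \bigcup_(y in [set y | lt y x]) B y.
  apply: Good_chain => [y yx|y z _ _ /mB//]; split; first exact: cl_closed.
  rewrite /B.
  (* Moving [y] among the countably many extra generators turns [B y] into the closure of a strict
     segment, where the induction hypothesis applies. *)
  have -> : [set z | lt z y \/ z = y] `|` C = [set z | lt z y] `|` (C `|` [set y]).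
    by apply/seteqP; split=> z; rewrite /setU/=; tauto.
  by apply: IH => //; apply: countable_setU.
apply/seteqP; split; last first.
  move=> v [y yx]; apply: cl_mono => z [[zy|->]|Cz]; last by right.
    by left; apply: lt_trans yx.
  by left.
apply: cl_min.
  apply: closed_chain; [by move=> y _; exact: cl_closed| |by exists y0].
  by move=> y z _ _ /mB.
move=> z [zx|Cz]; first by exists z => //; apply: cl_base; left; right.
by exists y0 => //; apply: cl_base; right.
Qed.

(** The closures of the segments up to and including [y] form a chain, and each [y] lies in its own
    one. *)
Lemma Good_setT : Good setT.
Proof.
pose B y := cl ([set z | lt z y] `|` [set y]).
have -> : setT = \bigcup_(y in setT) B y.
  by apply/seteqP; split=> // v _; exists v => //; apply: cl_base; right.
apply: Good_chain => [y _|y z _ _ yz].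
  split; first exact: cl_closed.
  exact: Good_segment.
apply: cl_mono => w [wy|->]; first by left; apply: lt_trans yz.
by left.
Qed.

End Closure.

(** * Limits along ultrafilters and compactness *)

Definition ulim (I : Type) (U : set_system I) (u : I -> R) (l : R) :=
  forall e : R, 0 < e -> U [set i | `|u i - l| < e].

Section UltraLimits.
Variables (I : Type) (U : set_system I).
Hypothesis UU : UltraFilter U.

Lemma ultra_ex (A : set I) : U A -> A !=set0.
Proof. exact: filter_ex. Qed.

Lemma ulim_near (u v : I -> R) l :
  ulim U u l -> U [set i | u i = v i] -> ulim U v l.
Proof. by move=> ul uv e e0; apply: filterS2 (ul _ e0) uv => i /= + <-. Qed.

Lemma ulim_cst (l : R) : ulim U (fun=> l) l.
Proof.
by move=> e e0; apply: filterS filterT => i _ /=; rewrite subrr normr0.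
Qed.

Lemma ulim_lin (u v : I -> R) (a b k : R) :
  ulim U u a -> ulim U v b -> ulim U (fun i => u i + k * v i) (a + k * b).
Proof.
move=> ua vb e e0.
have k0 : 0 < `|k| + 1 by rewrite ltr_wpDl.
have e20 : 0 < e / 2 by rewrite divr_gt0.
apply: filterS2 (ua _ e20) (vb (e / 2 / (`|k| + 1)) _) => /= [i ui vi|]; last first.
  by rewrite divr_gt0.
have -> : u i + k * v i - (a + k * b) = (u i - a) + k * (v i - b).
  by rewrite mulrBr opprD addrACA.
rewrite (le_lt_trans (ler_normD _ _))// [ltRHS](splitr e) ltr_leD//.
rewrite normrM; apply: le_trans (_ : (`|k| + 1) * `|v i - b| <= _).
  by rewrite ler_wpM2r// lerDl.
by rewrite mulrC -ler_pdivlMr// ltW.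
Qed.

Lemma ulimB (u v : I -> R) (a b : R) :
  ulim U u a -> ulim U v b -> ulim U (fun i => u i - v i) (a - b).
Proof.
move=> ua vb e e0; have := ulim_lin (-1) ua vb e0.
by apply: filterS => i /=; rewrite !mulN1r.
Qed.

Lemma ulim_uniq (u : I -> R) (a b : R) : ulim U u a -> ulim U u b -> a = b.
Proof.
move=> ua ub; apply/eqP; rewrite -subr_eq0 -normr_le0 leNgt; apply/negP => ab.
have [i /=] := ultra_ex (ulimB ua ub ab).
by rewrite subrr sub0r normrN ltxx.
Qed.

Lemma ulim_le (u : I -> R) (a c : R) :
  ulim U u a -> U [set i | u i <= c] -> a <= c.
Proof.
move=> ua uc; rewrite leNgt; apply/negP => ca.
have ac0 : 0 < a - c by rewrite subr_gt0.
have [i [/= h1 h2]] := ultra_ex (filterI (ua _ ac0) uc).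
move: h1; rewrite distrC ltNge => /negP; apply.
by rewrite (le_trans _ (ler_norm _))// lerB.
Qed.

Lemma ulim_norm (u : I -> R) (a : R) : ulim U u a -> ulim U (fun i => `|u i|) `|a|.
Proof.
move=> ua e e0; apply: filterS (ua e e0) => i /=.
exact/le_lt_trans/ler_dist_dist.
Qed.

Lemma ulim_not_gt (u : I -> R) (a : R) (e : R) :
  0 < e -> ulim U u a -> U [set i | e <= `|u i - a|] -> False.
Proof.
move=> e0 ua ue; have [i [/= h1 h2]] := ultra_ex (filterI (ua _ e0) ue).
by move: h1; rewrite ltNge h2.
Qed.

Lemma ultra_finite_union n (A : 'I_n -> set I) :
  U (\bigcup_i A i) -> exists i, U (A i).
Proof.
move=> UA; apply: contrapT => N.
have : U (\bigcap_i ~` A i).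
  have : U (\bigcap_(i in [set` enum 'I_n]) ~` A i).
    elim: (enum 'I_n) => [|i s IH].
      by apply: filterS filterT => x _ i; rewrite /= in_nil.
    have [Ai|Ai] := in_ultra_setVsetC (A i) UU; first by case: N; exists i.
    apply: filterS2 Ai IH => x xi xs j /=; rewrite inE => /orP[/eqP->//|js].
    exact: xs.
  by apply: filterS => x xA i _; apply: xA; rewrite /= mem_enum.
move=> UB; have [x [[i _ xi] xB]] := ultra_ex (filterI UA UB).
exact: (xB i).
Qed.

End UltraLimits.

(** An index is a finite list from [M] with a precision. Along [U] the list eventually contains any
    given element of [M] and the precision passes any bound, so limits along [U] turn finite
    approximations into exact equalities. *)
Lemma index_ultra (Z : Type) (M : set Z) :
  exists U : set_system (seq Z * nat), [/\ UltraFilter U,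
    U [set i | forall z, List.In z i.1 -> M z],
    forall z, M z -> U [set i | List.In z i.1] &
    forall m, U [set i | (m <= i.2)%N]].
Proof.
pose D := [set i : seq Z * nat | forall z, List.In z i.1 -> M z].
pose B (i : seq Z * nat) := [set j : seq Z * nat |
  [/\ D j, forall z, List.In z i.1 -> List.In z j.1 & (i.2 <= j.2)%N]].
have FF : ProperFilter (filter_from D B).
  apply: filter_from_proper => [|i Di]; last by exists i; split.
  apply: filter_from_filter; first by exists ([::], 0%N).
  move=> i j Di Dj; exists (i.1 ++ j.1, maxn i.2 j.2).
    by move=> z /List.in_app_iff[/Di|/Dj].
  move=> k [Dk lk]; rewrite geq_max => /andP[ik jk].
  by split; split=> // z zi; apply: lk; apply/List.in_app_iff; [left|right].
have [U [UU FU]] := ultraFilterLemma FF.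
exists U; split=> // [|z Mz|m]; apply: FU.
- by exists ([::], 0%N) => // i [].
- exists ([:: z], 0%N); first by move=> w /= [<-|].
  by move=> i [_ zi _]; apply: zi; left.
- by exists ([::], m) => // i [].
Qed.

Lemma nat_ultra : exists U : set_system nat, UltraFilter U /\
  forall m, U [set i | (m <= i)%N].
Proof.
have FF : ProperFilter (filter_from setT (fun m => [set i | (m <= i)%N])).
  by apply: filter_from_proper => i _; exists i => /=.
have [U [UU FU]] := ultraFilterLemma FF.
by exists U; split=> // m; apply: FU; exists m.
Qed.

Definition ucompact (A : Type) (F : set (A -> R)) (K : set A) :=
  forall (I : Type) (U : set_system I) (x : I -> A), UltraFilter U ->
    (forall i, K (x i)) ->
    exists2 l, K l & forall f, F f -> ulim U (fun i => f (x i)) (f l).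

Lemma Fbasic_open (A : Type) (F : set (A -> R)) (Y : set A) n
    (fs : 'I_n -> A -> R) (x : A) (e : R) :
  (forall i, F (fs i)) ->
  Fopen_in F Y [set y | forall i, `|fs i y - fs i x| < e].
Proof.
move=> Ff z _ /= zx; exists n, fs; split=> //.
have [d d0 dP] : exists2 d, 0 < d & forall i, `|fs i z - fs i x| + d <= e.
  have : exists2 d, 0 < d & forall i, i \in enum 'I_n -> `|fs i z - fs i x| + d <= e.
    elim: (enum 'I_n) => [|i s [d d0 IH]]; first by exists 1.
    exists (Num.min d (e - `|fs i z - fs i x|)).
      by rewrite lt_min d0 subr_gt0 zx.
    move=> j; rewrite inE => /orP[/eqP->|/IH].
      by rewrite -lerBrDl ge_min lexx orbT.
    by apply: le_trans; rewrite lerD2l ge_min lexx.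
  by move=> [d d0 dP]; exists d => // i; apply: dP; rewrite mem_enum.
exists d; split=> // y _ yz i.
apply: lt_le_trans (dP i); rewrite [ltRHS]addrC (le_lt_trans (ler_distD (fs i z) _ _))//.
by rewrite ltrD2r.
Qed.

(** If no point of [K] were a limit, the open sets containing the terms of the family only for a
    [U]-null set of indices would cover [K]; but one set of a finite subcover must contain them
    [U]-almost always. *)
Lemma Fcompact_ucompact (A : Type) (F : set (A -> R)) (Y K : set A) :
  Fcompact_in F Y K -> ucompact F K.
Proof.
move=> [KY cK] I U x UU Kx; apply: contrapT => N.
pose C := [set O : set A | Fopen_in F Y O /\ ~ U [set i | O (x i)]].
have [O []//|k Kk|n [g [Cg Kg]]] := cK C.
  have [f [Ff [e [e0 Ne]]]] : exists f, F f /\ exists e : R, 0 < e /\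
      ~ U [set i | `|f (x i) - f k| < e].
    apply: contrapT => N'; apply: N; exists k => // f Ff e e0.
    by apply: contrapT => Ne; apply: N'; exists f; split=> //; exists e.
  exists [set y | forall i : 'I_1, `|f y - f k| < e]; last first.
    by move=> _; rewrite subrr normr0.
  split; first exact: (@Fbasic_open _ F Y 1 (fun=> f)).
  move=> Ue; apply: Ne; apply: filterS Ue => i /=; apply; exact: ord0.
have : U (\bigcup_i [set j | g i (x j)]).
  by apply: filterS filterT => j _; have [i _ gi] := Kg _ (Kx j); exists i.
by move=> /(ultra_finite_union UU)[i]; apply: (Cg i).2.
Qed.

(* continuity on Y, with limits along ultrafilters in place of neighbourhoods *)
Definition ucont (G : Type) (Y : set (G -> R)) (f : (G -> R) -> R) :=
  forall (I : Type) (U : set_system I) (x : I -> G -> R) l, UltraFilter U ->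
    (forall i, Y (x i)) -> Y l ->
    (forall g, ulim U (fun i => x i g) (l g)) -> ulim U (fun i => f (x i)) (f l).

Lemma Fcont_ulim (A B : Type) (F : set (A -> R)) (Y : set A)
    (E : set (B -> R)) (h : A -> B) (I : Type) (U : set_system I)
    (x : I -> A) (l : A) (g : B -> R) : UltraFilter U ->
  Fcont F Y E h -> (forall i, Y (x i)) -> Y l ->
  (forall f, F f -> ulim U (fun i => f (x i)) (f l)) ->
  E g -> ulim U (fun i => g (h (x i))) (g (h l)).
Proof.
move=> UU hc Yx Yl xl Eg e e0.
have [n [fs [Ff [d [d0 dP]]]]] := hc l Yl g Eg e e0.
have : U [set i | forall j, j \in enum 'I_n -> `|fs j (x i) - fs j l| < d].
  elim: (enum 'I_n) => [|j s IH]; first exact: filterS filterT.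
  apply: filterS2 (xl _ (Ff j) d d0) IH => i /= ij js k.
  by rewrite inE => /orP[/eqP->//|/js].
by apply: filterS => i /= ij; apply: dP => // j; apply: ij; rewrite mem_enum.
Qed.

Section CompactQ.
Variables (G : Type) (Q : set (G -> R)).
Hypothesis cQ : ucompact (@coords G) Q.

Lemma Qlimit (I : Type) (U : set_system I) (x : I -> G -> R) :
  UltraFilter U -> (forall i, Q (x i)) ->
  exists2 l, Q l & forall g, ulim U (fun i => x i g) (l g).
Proof.
move=> UU Qx; have [l Ql lP] := cQ UU Qx; exists l => // g.
by apply: (lP (fun y => y g)); exists g.
Qed.

Lemma ucont_bounded (f : (G -> R) -> R) : ucont Q f ->
  exists C, forall x, Q x -> `|f x| <= C.
Proof.
move=> fc; apply: contrapT => N.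
have /choice[x xP] : forall n : nat, exists x, Q x /\ n%:R < `|f x|.
  move=> n; apply: contrapT => Nn; apply: N; exists n%:R => x Qx.
  by rewrite leNgt; apply/negP => h; apply: Nn; exists x.
have [U [UU Ut]] := nat_ultra.
have [l Ql xl] := Qlimit UU (fun i => (xP i).1).
have := ulim_norm UU (fc _ _ _ _ UU (fun i => (xP i).1) Ql xl).
move=> /(_ 1 ltr01) h.
have [m mP] : exists m : nat, `|f l| + 1 < m%:R.
  by exists (Num.bound (`|f l| + 1)); rewrite archi_boundP// addr_ge0.
have [i [/= h1 h2]] := ultra_ex UU (filterI h (Ut m)).
have : `|f (x i)| < `|f l| + 1.
  by rewrite -ltrBlDl (le_lt_trans (ler_norm _)).
apply/negP; rewrite -leNgt (le_trans (ltW mP))// ltW//.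
by rewrite (le_lt_trans _ (xP i).2)// ler_nat.
Qed.

(** Up to [1/(n+1)], finitely many coordinates determine [f]: otherwise pairs agreeing on ever
    larger finite sets, with values of [f] kept apart, would converge to one common point. *)
Lemma ucont_support (f : (G -> R) -> R) : ucont Q f ->
  exists2 C, countable C & forall x y, Q x -> Q y ->
    (forall g, C g -> x g = y g) -> f x = f y.
Proof.
move=> fc.
have /choice[F FP] : forall n : nat, exists s : seq G, forall x y, Q x -> Q y ->
    (forall g, List.In g s -> x g = y g) -> `|f x - f y| < n.+1%:R^-1.
  move=> n; apply: contrapT => N.
  have /choice[x xP] : forall s : seq G, exists z : (G -> R) * (G -> R),
      [/\ Q z.1, Q z.2, forall g, List.In g s -> z.1 g = z.2 g &
       n.+1%:R^-1 <= `|f z.1 - f z.2| ].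
    move=> s; apply: contrapT => Ns; apply: N; exists s => x y Qx Qy xy.
    by rewrite ltNge; apply/negP => h; apply: Ns; exists (x, y).
  have [U [UU _ UG _]] := index_ultra (@setT G).
  have Q1 (i : seq G * nat) : Q (x i.1).1 by case: (xP i.1).
  have Q2 (i : seq G * nat) : Q (x i.1).2 by case: (xP i.1).
  have [l Ql lP] := Qlimit UU Q1.
  have [l' Ql' lP'] := Qlimit UU Q2.
  have ll : l = l'.
    apply/funext => g; apply: (ulim_uniq UU (lP g)).
    apply: (ulim_near UU (lP' g)); apply: filterS (UG g I) => i gi /=.
    by case: (xP i.1) => _ _ /(_ g gi).
  have /(ulimB UU)/(_ (fc _ _ _ _ UU Q2 Ql' lP')) := fc _ _ _ _ UU Q1 Ql lP.
  rewrite ll subrr => h.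
  have n0 : 0 < n.+1%:R^-1 :> R by rewrite invr_gt0.
  apply: (ulim_not_gt UU n0 h).
  by apply: filterS filterT => i _ /=; rewrite subr0; case: (xP i.1).
exists (\bigcup_n [set g | List.In g (F n)]).
  apply: bigcup_countable => // n _.
  apply: finite_set_countable; elim: (F n) => [|g s IH].
    by rewrite (_ : [set _ | _] = set0)//; apply/seteqP; split.
  rewrite (_ : [set _ | _] = [set g] `|` [set h | List.In h s]).
    by rewrite finite_setU; split.
  by apply/seteqP; split=> h /= [->|]; by [left|right].
move=> x y Qx Qy xy; apply/eqP; rewrite -subr_eq0 -normr_le0 leNgt.
apply/negP => h0.
pose n := Num.bound (`|f x - f y|^-1).
have h1 : `|f x - f y| < n.+1%:R^-1.
  by apply: FP => // g gn; apply: xy; exists n.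
move: h1; rewrite ltNge => /negP; apply.
rewrite invf_ple ?posrE//.
rewrite (le_trans (ltW (archi_boundP _)))// ?invr_ge0//.
by rewrite ler_nat.
Qed.

End CompactQ.

(** * Closing off, and jumps along chains *)

(** Start at the least element of [E] and keep passing to the next one. The invariant [P], that only
    finitely many elements of [E] fail to lie above the current one, guarantees a successor. *)
Lemma infinite_increasing (V : Type) (lt : V -> V -> Prop) (E : set V) :
  well_founded lt -> (forall x y, [\/ lt x y, x = y | lt y x]) ->
  infinite_set E -> exists y : nat -> V, forall n, E (y n) /\ lt (y n) (y n.+1).
Proof.
move=> wf tot Einf.
have min (A : set V) : A !=set0 -> exists2 z, A z & forall x, A x -> ~ lt x z.
  move=> [x Ax]; apply: contrapT => N; elim/(well_founded_ind wf): x Ax => x IH Ax.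
  by apply: N; exists x => // y Ay yx; apply: (IH y).
pose P y := E y /\ finite_set [set z | E z /\ ~ lt y z].
have [y0 Py0] : exists y, P y.
  have [y Ey ymin] := min E (infinite_setN0 Einf).
  exists y; split=> //; apply: sub_finite_set (finite_set1 y) => z [Ez yz].
  by have [//|->|/ymin] := tot y z.
have /choice[next nextP] : forall y : {y | P y}, exists z : {y | P y},
    lt (sval y) (sval z).
  move=> [y [Ey fy]] /=.
  have [|z [Ez yz] zmin] := min [set z | E z /\ lt y z].
    apply: contrapT => N; apply: Einf; apply: sub_finite_set fy => z Ez.
    by split=> // yz; apply: N; exists z.
  have Pz : P z.
    split=> //; suff : finite_set ([set w | E w /\ ~ lt y w] `|` [set z]).
      apply: sub_finite_set => w [Ew zw].
      have [yw|yw] := pselect (lt y w); last by left.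
      by right; have [//|->//|wz] := tot z w; case: (zmin w).
    by rewrite finite_setU.
  by exists (exist _ z Pz).
exists (fun n => sval (iter n next (exist _ y0 Py0))) => n; split.
  exact: (svalP (iter n next (exist _ y0 Py0))).1.
exact: nextP.
Qed.

Lemma infinite_injection (T : Type) (E : set T) :
  infinite_set E -> exists y : nat -> T, injective y /\ forall n, E (y n).
Proof.
have [lt [wf tr tot]] := well_ordering T.
move=> /(infinite_increasing wf tot)[y yP]; exists y; split; last first.
  by move=> n; case: (yP n).
have mono m n : (m < n)%N -> lt (y m) (y n).
  elim: n => // n IH; rewrite ltnS leq_eqVlt => /orP[/eqP->|/IH mn].
    exact: (yP n).2.
  exact: tr mn (yP n).2.
have irr z : ~ lt z z by elim/(well_founded_ind wf): z => z IH zz; exact: (IH z zz).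
move=> m n ymn; have [mn|nm|//] := ltngtP m n.
  by have := mono _ _ mn; rewrite ymn => /irr.
by have := mono _ _ nm; rewrite ymn => /irr.
Qed.

Lemma ratr_approx (m : nat) (r : R) : exists q : rat, `|r - ratr q| < m.+1%:R^-1.
Proof.
have m0 : 0 < m.+1%:R^-1 :> R by rewrite invr_gt0.
have [|q] := @rat_in_itvoo R (r - m.+1%:R^-1) (r + m.+1%:R^-1).
  by rewrite ltrD2l gtrN.
rewrite in_itv/= => /andP[h1 h2]; exists q.
by rewrite ltr_distlC h1.
Qed.

Lemma In_zip_map (Z A B : Type) (a : Z -> A) (b : Z -> B) (s : seq Z) u v :
  List.In (u, v) (zip (map a s) (map b s)) ->
  exists z, [/\ List.In z s, u = a z & v = b z].
Proof.
elim: s => //= z s IH [[<- <-]|/IH[w [ws -> ->]]]; first by exists z; split; [left| |].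
by exists w; split; [right| |].
Qed.

Lemma In_map (Z A : Type) (a : Z -> A) (s : seq Z) u :
  List.In u (map a s) -> exists2 z, List.In z s & u = a z.
Proof.
elim: s => //= z s IH [<-|/IH[w ws ->]]; first by exists z; [left|].
by exists w; [right|].
Qed.

Lemma In_zip_map_mem (Z A B : Type) (a : Z -> A) (b : Z -> B) (s : seq Z) z :
  List.In z s -> List.In (a z, b z) (zip (map a s) (map b s)).
Proof. by elim: s => //= w s IH [->|/IH]; [left|right]. Qed.

Lemma ulim_index (S : Type) (U : set_system (S * nat)) (u : S * nat -> R) (a : R) :
  UltraFilter U -> (forall m, U [set i | (m <= i.2)%N]) ->
  U [set i | `|u i - a| <= i.2.+1%:R^-1 *+ 2] -> ulim U u a.
Proof.
move=> UU Um Ua e e0.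
pose m := Num.bound ((e / 2)^-1).
apply: filterS2 (Um m) Ua => i /= mi /le_lt_trans; apply.
rewrite -[ltLHS]mulr_natr -ltr_pdivlMr// invf_plt ?posrE ?divr_gt0//.
apply: lt_le_trans (archi_boundP _) _; first by rewrite invr_ge0 divr_ge0// ltW.
by rewrite ler_nat (leq_trans mi).
Qed.

Lemma countable_image (A B : Type) (f : A -> B) (X : set A) :
  countable X -> countable (f @` X).
Proof. exact/card_le_trans/card_image_le. Qed.

Definition rst (G : Type) (A : set G) (x : G -> R) : G -> R :=
  fun g => if `[< A g >] then x g else 0.

Section Restriction.
Variable G : Type.
Implicit Types (A B : set G) (x : G -> R).

Lemma rst_in A x g : A g -> rst A x g = x g.
Proof. by move=> Ag; rewrite /rst asboolT. Qed.

Lemma rst_out A x g : ~ A g -> rst A x g = 0.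
Proof. by move=> Ag; rewrite /rst asboolF. Qed.

Lemma rst_rstl A B x : A `<=` B -> rst A (rst B x) = rst A x.
Proof.
move=> AB; apply/funext => g; have [Ag|Ag] := pselect (A g).
  by rewrite !rst_in//; apply: AB.
by rewrite !rst_out.
Qed.

Lemma rst_rstr A B x : A `<=` B -> rst B (rst A x) = rst A x.
Proof.
move=> AB; apply/funext => g; have [Bg|Bg] := pselect (B g).
  by rewrite rst_in.
by rewrite !rst_out// => /AB.
Qed.

End Restriction.

Section ClosingOff.
Variables (G : Type) (Q : set (G -> R)) (H : set ((G -> R) -> R)).
Hypotheses (cQ : ucompact (@coords G) Q)
  (Q_countable : forall x, Q x -> countable [set g | x g <> 0])
  (H_cont : forall f, H f -> ucont Q f)
  (H_compact : ucompact [set ev | exists2 x, Q x & ev = fun f => f x] H).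

(** Agreement with [f \o rst A] is asked on [Q] only, since members of [H] are total functions whose
    values off [Q] carry no information. *)
Definition projects A := (forall x, Q x -> Q (rst A x)) /\
  forall f, H f -> exists2 g, H g & forall x, Q x -> g x = f (rst A x).

Lemma Hlimit (I : Type) (U : set_system I) (f : I -> (G -> R) -> R) :
  UltraFilter U -> (forall i, H (f i)) ->
  exists2 l, H l & forall x, Q x -> ulim U (fun i => f i x) (l x).
Proof.
move=> UU Hf; have [l Hl lP] := H_compact UU Hf; exists l => // x Qx.
by apply: (lP (fun h => h x)); exists x.
Qed.

(* Elements of Gamma, points of Q and functions in H are closed off together;
   only lists of elements of one kind at a time matter. *)
Definition universe := (G + (G -> R) + ((G -> R) -> R))%type.
Definition elt (g : G) : universe := inl (inl g).
Definition pnt (x : G -> R) : universe := inl (inr x).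
Definition fct (f : (G -> R) -> R) : universe := inr f.
Definition elts (M : set universe) : set G := [set g | M (elt g)].

(** A Loewenheim-Skolem argument: the rules add witnesses in [Q] and in [H] for finite approximate
    patterns, and countable supports of all points and functions met. Limits of witnesses from [M]
    then realise [rst A x] and [f \o rst A]. *)
Lemma closing_off : exists c : seq universe -> set universe,
  (forall l, countable (c l)) /\
  forall M, closed_under c M -> projects (elts M).
Proof.
(* Rational values and precisions [1/(m+1)] leave only countably many patterns over a given list. *)
pose pat (l : seq (universe * rat)) m x := Q x /\
  forall g q, List.In (elt g, q) l -> `|x g - ratr q| < m.+1%:R^-1.
have /choice[xx xxP] : forall p : seq (universe * rat) * nat, exists x,
    (exists y, pat p.1 p.2 y) -> pat p.1 p.2 x.
  move=> p; have [[y py]|N] := pselect (exists y, pat p.1 p.2 y).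
    by exists y.
  by exists (fun=> 0).
pose fpat (l : seq (universe * rat)) m f := H f /\
  forall x q, List.In (pnt x, q) l -> `|f x - ratr q| < m.+1%:R^-1.
have /choice[ff ffP] : forall p : seq (universe * rat) * nat, exists f,
    (exists h, fpat p.1 p.2 h) -> fpat p.1 p.2 f.
  move=> p; have [[y py]|N] := pselect (exists y, fpat p.1 p.2 y).
    by exists y.
  by exists (fun=> 0).
have /choice[sf sfP] : forall f : (G -> R) -> R, exists C : set G, countable C /\
    (H f -> forall x y, Q x -> Q y -> (forall g, C g -> x g = y g) -> f x = f y).
  move=> f; have [Hf|N] := pselect (H f); last by exists set0; split.
  by have [C cC CP] := ucont_support cQ (H_cont Hf); exists C.
pose supp (v : universe) : set universe := match v with
  | inl (inl g) => set0
  | inl (inr x) => [set elt g | g in [set g | Q x /\ x g <> 0]]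
  | inr f => [set elt g | g in sf f] end.
have supp_countable v : countable (supp v).
  case: v => [[g|x]|f] /=; first exact: countable0; apply: countable_image.
    have [Qx|Qx] := pselect (Q x).
      by apply: sub_countable (Q_countable Qx); apply: subset_card_le => g [].
    by rewrite (_ : [set _ | _] = set0)//; apply/seteqP; split=> g // [].
  by case: (sfP f).
pose c (l : seq universe) : set universe :=
  (range (fun p : seq rat * nat => pnt (xx (zip l p.1, p.2))) `|`
   range (fun p : seq rat * nat => fct (ff (zip l p.1, p.2)))) `|`
  \bigcup_(v in [set v | List.In v l]) supp v.
exists c; split.
  move=> l; apply: countable_setU.
    by apply: countable_setU; apply: countable_image; exact: countableP.
  apply: bigcup_countable => //; elim: l => [|v l IH].
    by rewrite (_ : [set _ | _] = set0)//; apply/seteqP; split.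
  rewrite (_ : [set _ | _] = [set v] `|` [set w | List.In w l]).
    exact: countable_setU.
  by apply/seteqP; split=> w /= [->|]; by [left|right].
move=> M cM; set A := elts M.
have pntM x : Q x -> M (pnt x) -> forall g, x g <> 0 -> A g.
  move=> Qx Mx g xg; apply: (cM [:: pnt x]); first by move=> v /= [<-|].
  by right; exists (pnt x) => /=; [left|exists g].
have fctM f : M (fct f) -> sf f `<=` A.
  move=> Mf g fg; apply: (cM [:: fct f]); first by move=> v /= [<-|].
  by right; exists (fct f) => /=; [left|exists g].
have /choice[qa qaP] : forall p : nat * R, exists q : rat,
    `|p.2 - ratr q| < p.1.+1%:R^-1.
  by move=> p; exact: ratr_approx.
(* Points from [M] that approximate [x] on finite subsets of [A] vanish off [A], because [M]
   contains their supports; their limit is therefore [rst A x]. *)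
have approx x : Q x -> exists (U : set_system (seq G * nat)) y,
    [/\ UltraFilter U, forall i, Q (y i), U [set i | M (pnt (y i))],
        Q (rst A x) & forall g, ulim U (fun i => y i g) (rst A x g)].
  move=> Qx; have [U [UU UA Uin Um]] := index_ultra A.
  pose l (i : seq G * nat) := zip (map elt i.1) (map (fun g => qa (i.2, x g)) i.1).
  pose y i := xx (l i, i.2).
  have yP i : pat (l i) i.2 (y i).
    apply: (xxP (l i, i.2)); exists x; split=> //= g q lg.
    have [h [_ [->] ->]] := @In_zip_map _ _ _ elt (fun g => qa (i.2, x g)) i.1 _ _ lg.
    exact: (qaP (i.2, x h)).
  have Qy i : Q (y i) by case: (yP i).
  have yM : U [set i | M (pnt (y i))].
    apply: filterS UA => i /= iA; apply: (cM (map elt i.1)).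
      by move=> v vi; have [g /iA Ag ->] := @In_map _ _ elt i.1 _ vi.
    by left; left; exists (map (fun g => qa (i.2, x g)) i.1, i.2).
  have [z Qz zP] := Qlimit cQ UU Qy.
  suff zE : z = rst A x by exists U, y; rewrite -zE; split.
  apply/funext => g; apply: (ulim_uniq UU (zP g)).
  have [Ag|Ag] := pselect (A g).
    rewrite rst_in//; apply: (ulim_index UU Um).
    apply: filterS (Uin _ Ag) => i /= gi.
    rewrite (le_trans (ler_distD (ratr (qa (i.2, x g))) _ _))// mulr2n lerD//.
      by have [_ /(_ g)] := yP i; move=> h; apply/ltW/h/In_zip_map_mem.
    by rewrite distrC ltW// (qaP (i.2, x g)).
  rewrite rst_out//; apply: (ulim_near UU (ulim_cst UU 0)).
  apply: filterS yM => i /= Myi.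
  by apply: contrapT => N; apply/Ag/(pntM _ (Qy i) Myi) => yi; apply: N.
have QA x : Q x -> Q (rst A x) by move=> /approx[U [y []]].
split=> // f Hf.
have [U [UU UA Uin Um]] := index_ultra [set x | Q x /\ M (pnt x)].
pose l (i : seq (G -> R) * nat) :=
  zip (map pnt i.1) (map (fun x => qa (i.2, f x)) i.1).
pose h i := ff (l i, i.2).
have hP i : fpat (l i) i.2 (h i).
  apply: (ffP (l i, i.2)); exists f; split=> //= x q lx.
  have [z [_ [->] ->]] := @In_zip_map _ _ _ pnt (fun x => qa (i.2, f x)) i.1 _ _ lx.
  exact: (qaP (i.2, f z)).
have Hh i : H (h i) by case: (hP i).
have hM : U [set i | M (fct (h i))].
  apply: filterS UA => i /= iA; apply: (cM (map pnt i.1)).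
    by move=> v vi; have [g /iA [_ Ag] ->] := @In_map _ _ pnt i.1 _ vi.
  by left; right; exists (map (fun x => qa (i.2, f x)) i.1, i.2).
have [g Hg gP] := Hlimit UU Hh.
exists g => // x Qx.
have gx : g x = g (rst A x).
  apply: (ulim_uniq UU (gP _ Qx)); apply: (ulim_near UU (gP _ (QA _ Qx))).
  apply: filterS hM => i /= Mi; apply/esym.
  have [_ sf_eq] := sfP (h i); apply: sf_eq => //; first exact: QA.
  by move=> k /(fctM _ Mi) Ak; rewrite rst_in.
have gf y : Q y -> M (pnt y) -> g y = f y.
  move=> Qy My; apply: (ulim_uniq UU (gP _ Qy)); apply: (ulim_index UU Um).
  apply: filterS (Uin y _) => // i /= gi.
  rewrite (le_trans (ler_distD (ratr (qa (i.2, f y))) _ _))// mulr2n lerD//.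
    have [_ h2] := hP i; apply/ltW/h2.
    exact: (In_zip_map_mem pnt (fun x => qa (i.2, f x))).
  by rewrite distrC ltW// (qaP (i.2, f y)).
(* [g] and [f] agree at points of [M], and [rst A x] is a limit of such points; continuity of both
   concludes. *)
rewrite gx; have [W [y [UW Qy yM Qr yr]]] := approx x Qx.
apply: (ulim_uniq UW (H_cont Hg UW Qy Qr yr)).
apply: (ulim_near UW (H_cont Hf UW Qy Qr yr)).
by apply: filterS yM => i /= Mi; rewrite gf.
Qed.

(** Let [a] and [b] be limits in [H] of [f i \o rst (C' i)] and [f i \o rst (C i)]. They agree at
    every [rst (C j) x], hence by continuity at the limit [rst D x], where the two sequences take
    exactly the values assumed to stay [e] apart. *)
Lemma projects_chain (C C' : nat -> set G) (f : nat -> (G -> R) -> R) x (e : R) :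
  (forall i, projects (C i)) -> (forall i, projects (C' i)) ->
  (forall i, C i `<=` C' i) -> (forall i, C' i `<=` C i.+1) ->
  (forall i, H (f i)) -> Q x -> 0 < e ->
  ~ forall i, e <= `|f i (rst (C' i) x) - f i (rst (C i) x)|.
Proof.
move=> pC pC' CC' CC Hf Qx e0 N.
have mC i j : (i <= j)%N -> C i `<=` C j.
  move=> /subnK <-; elim: (j - i)%N => // k IH g /IH gk.
  by rewrite addSn; apply/CC/CC'.
have [U [UU Um]] := nat_ultra.
have Qr i : Q (rst (C i) x) by apply: (pC i).1.
set D := \bigcup_i C i.
have rD g : ulim U (fun i => rst (C i) x g) (rst D x g).
  apply: (ulim_near UU (ulim_cst UU _)).
  have [[n _ gn]|gD] := pselect (D g).
    apply: filterS (Um n) => i /= ni.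
    by rewrite rst_in ?rst_in//; [exact: mC gn|exists n].
  apply: filterS filterT => i _ /=.
  by rewrite !rst_out// => gi; apply: gD; exists i.
have QD : Q (rst D x).
  have [z Qz zP] := Qlimit cQ UU Qr; suff -> : rst D x = z by [].
  by apply/funext => g; apply: (ulim_uniq UU (rD g) (zP g)).
have /choice[g gP] : forall i, exists g, H g /\ forall y, Q y -> g y = f i (rst (C' i) y).
  by move=> i; have [g Hg gE] := (pC' i).2 _ (Hf i); exists g.
have /choice[h hP] : forall i, exists g, H g /\ forall y, Q y -> g y = f i (rst (C i) y).
  by move=> i; have [h Hh hE] := (pC i).2 _ (Hf i); exists h.
have [a Ha aP] := Hlimit UU (fun i => (gP i).1).
have [b Hb bP] := Hlimit UU (fun i => (hP i).1).
have ab j : a (rst (C j) x) = b (rst (C j) x).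
  apply: (ulim_uniq UU (aP _ (Qr j))); apply: (ulim_near UU (bP _ (Qr j))).
  apply: filterS (Um j) => i /= ji.
  have Cji := mC _ _ ji; have CCji := subset_trans Cji (CC' i).
  by rewrite (gP i).2// (hP i).2// !rst_rstr.
have abD : a (rst D x) = b (rst D x).
  apply: (ulim_uniq UU (H_cont Ha UU Qr QD rD)).
  apply: (ulim_near UU (H_cont Hb UU Qr QD rD)).
  by apply: filterS filterT => i _ /=; rewrite ab.
have := ulimB UU (aP _ QD) (bP _ QD); rewrite abD subrr => h0.
apply: (ulim_not_gt UU e0 h0); apply: filterS filterT => i _ /=.
have CD k : C k `<=` D by exact: (@bigcup_sup _ _ k).
have C'D := subset_trans (CC i) (CD i.+1).
by rewrite subr0 (gP i).2// (hP i).2// !rst_rstl.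
Qed.

Variables (lt : universe -> universe -> Prop) (I : set universe)
  (B : universe -> set G).
Hypotheses (lt_wf : well_founded lt)
  (lt_total : forall x y, [\/ lt x y, x = y | lt y x])
  (pB : forall y, I y -> projects (B y))
  (mB : forall y z, I y -> I z -> lt y z -> B y `<=` B z).

Definition below (y : universe) : set universe := [set z | I z /\ lt z y].
Definition lower (y : universe) : set G := \bigcup_(z in below y) B z.

Lemma lower_sub y : I y -> lower y `<=` B y.
Proof. by move=> Iy g [z [Iz zy]]; exact: mB. Qed.

Hypothesis p_lower : forall y, I y -> below y !=set0 -> projects (lower y).

(** Infinitely many jumps would include an increasing sequence [y n], and the sets [lower (y n)],
    [B (y n)], [lower (y n.+1)] interleave as [projects_chain] forbids. *)
Lemma finite_jumps x (e : R) : Q x -> 0 < e ->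
  finite_set [set y | [/\ I y, below y !=set0 &
    exists2 f, H f & e <= `|f (rst (B y) x) - f (rst (lower y) x)|]].
Proof.
move=> Qx e0; apply: contrapT => /(infinite_increasing lt_wf lt_total)[y yP].
have /choice[f fP] : forall n, exists f, H f /\
    e <= `|f (rst (B (y n)) x) - f (rst (lower (y n)) x)|.
  by move=> n; have [[_ _ [f Hf fe]] _] := yP n; exists f.
have Iy n : I (y n) by have [[]] := yP n.
apply: (@projects_chain (fun n => lower (y n)) (fun n => B (y n)) f x e) => //.
- by move=> n; apply: p_lower => //; have [[]] := yP n.
- by move=> n; apply: pB.
- by move=> n; exact: lower_sub.
- by move=> n g gn; exists (y n) => //; split=> //; exact: (yP n).2.
- by move=> n; case: (fP n).
- by move=> n; case: (fP n).
Qed.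

End ClosingOff.

(** * Decompositions of the index set *)

Section Decompositions.
Variables (G : Type) (Q : set (G -> R)) (H : set ((G -> R) -> R)).
Hypotheses (cQ : ucompact (@coords G) Q)
  (Q_countable : forall x, Q x -> countable [set g | x g <> 0])
  (H_cont : forall f, H f -> ucont Q f)
  (H_compact : ucompact [set ev | exists2 x, Q x & ev = fun f => f x] H).

(** Transfinite induction in the universe, seen through the traces on [G]. A nonempty union of a
    chain of closed sets is closed, so the sets [lower] project as well. *)
Lemma projects_ind (Good : set G -> Prop) :
  (forall A, countable A -> projects Q H A -> Good A) ->
  (forall (lt : universe G -> universe G -> Prop) (I : set (universe G))
      (B : universe G -> set G),
    well_founded lt -> (forall x y, [\/ lt x y, x = y | lt y x]) ->
    (forall y, I y -> projects Q H (B y)) ->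
    (forall y, I y -> Good (B y)) ->
    (forall y z, I y -> I z -> lt y z -> B y `<=` B z) ->
    (forall y, I y -> below lt I y !=set0 -> projects Q H (lower lt I B y)) ->
    Good (\bigcup_(y in I) B y)) ->
  Good setT.
Proof.
move=> base step.
have [c [cc cP]] := closing_off cQ Q_countable H_cont H_compact.
have [lt [wf tr tot]] := well_ordering (universe G).
pose GoodM (M : set (universe G)) := Good (elts M).
apply: (@Good_setT _ c cc lt wf tr tot GoodM) => [M cM countM|I B BP mB].
  apply: base; last exact: cP.
  have /countable_injP[h hI] := countM.
  apply/countable_injP; exists (h \o @elt G) => x y xM yM /hI.
  by rewrite !inE in xM yM * => /(_ xM yM)[].
apply: (step lt I (fun y => elts (B y))) => //.
- by move=> y /BP[cB _]; apply: cP.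
- by move=> y /BP[].
- by move=> y z Iy Iz /(mB _ _ Iy Iz) yz g; apply: yz.
- move=> y Iy ne.
  apply: (cP (\bigcup_(z in below lt I y) B z)).
  apply: (closed_chain tot) => //.
    by move=> z [/BP[]].
  by move=> z w [Iz _] [Iw _]; apply: mB.
Qed.

(** Totality allows at most one such index. It is treated apart because [finite_jumps] speaks only
    of indices with something below them. *)
Lemma finite_minimal (W : Type) (lt : W -> W -> Prop) (I : set W) :
  (forall x y, [\/ lt x y, x = y | lt y x]) ->
  finite_set [set y | I y /\ ~ ([set z | I z /\ lt z y] !=set0)].
Proof.
move=> tot; have [[y [Iy ymin]]|N] :=
  pselect (exists y, I y /\ ~ ([set z | I z /\ lt z y] !=set0)).
  apply: sub_finite_set (finite_set1 y) => z [Iz zmin] /=.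
  by have [zy|//|yz] := tot z y; [case: ymin; exists z|case: zmin; exists y].
rewrite (_ : [set _ | _] = set0)//; apply/seteqP; split=> // y yP.
by apply: N; exists y.
Qed.

Lemma ex_level (W : Type) (lt : W -> W -> Prop) (I : set W) (B : W -> set G) g :
  well_founded lt -> (\bigcup_(y in I) B y) g ->
  exists y, [/\ I y, B y g & ~ (\bigcup_(z in [set z | I z /\ lt z y]) B z) g].
Proof.
move=> wf [y0 Iy0 gy0]; apply: contrapT => N.
elim/(well_founded_ind wf): y0 Iy0 gy0 => y IH Iy gy.
by apply: N; exists y; split=> // -[z [Iz zy] gz]; exact: (IH z).
Qed.

(** Along a chain, [g] takes its colour from the first level containing it. If [x g] is nonzero,
    restricting [x] to that level and to the union below gives points differing at [g], so
    separation makes the level a jump; there are finitely many jumps, each with finitely many points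
    of the colour. *)
Lemma colouring (mm : G -> nat) :
  (forall g x y, Q x -> Q y -> x g <> y g ->
     exists2 f, H f & (mm g).+1%:R^-1 <= `|f x - f y|) ->
  exists col : G -> nat, forall x j, Q x ->
    finite_set [set g | x g <> 0 /\ col g = j].
Proof.
move=> sep.
(* The separation index is kept at a fixed [m] during the induction, so that one jump size serves
   all coordinates concerned; it is merged into the colour afterwards. *)
pose Good A := exists col : G -> nat, forall x j m, Q x ->
  finite_set [set g | [/\ A g, x g <> 0, col g = j & mm g = m]].
suff [col colP] : Good setT.
  exists (fun g => pickle (mm g, col g)) => x j Qx.
  have [[g [xg gj]]|N] := pselect (exists g, x g <> 0 /\ pickle (mm g, col g) = j).
    apply: sub_finite_set (colP x (col g) (mm g) Qx) => h [xh hj].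
    have : pickle (mm g, col g) = pickle (mm h, col h) by rewrite hj.
    by move=> /(pcan_inj pickleK)[-> ->].
  rewrite (_ : [set _ | _] = set0)//; apply/seteqP; split=> // y yP.
  by apply: N; exists y.
apply: projects_ind => [A /countable_injP[h hI] pA|lt I B wf tot pB gB mB pl].
  exists h => x j m Qx.
  have [[g [Ag gj]]|N] := pselect (exists g, A g /\ h g = j).
    apply: sub_finite_set (finite_set1 g) => k [Ak _ kj _] /=.
    by apply: hI; rewrite ?inE// gj kj.
  rewrite (_ : [set _ | _] = set0)//; apply/seteqP; split=> // y [Ay _ yj _].
  by apply: N; exists y.
have /choice[col colP] : forall y, exists col : G -> nat, I y ->
    forall x j m, Q x ->
    finite_set [set g | [/\ B y g, x g <> 0, col g = j & mm g = m]].
  move=> y; have [/gB[col colP]|N] := pselect (I y); last by exists (fun=> 0%N).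
  by exists col.
have /choice[lev levP] : forall g, exists y, (\bigcup_(y in I) B y) g ->
    [/\ I y, B y g & ~ lower lt I B y g].
  move=> g; have [/(ex_level wf)[y yP]|N] := pselect ((\bigcup_(y in I) B y) g).
    by exists y.
  by exists (elt g).
exists (fun g => col (lev g) g) => x j m Qx.
have m0 : 0 < m.+1%:R^-1 :> R by rewrite invr_gt0.
have fJ := finite_jumps cQ H_cont H_compact wf tot pB mB pl Qx m0.
have fM := finite_minimal I tot.
set J := [set y | _] in fJ; set N := [set y | _] in fM.
have : finite_set (\bigcup_(y in J `|` N)
    [set g | [/\ B y g, x g <> 0, col y g = j & mm g = m]]).
  apply: bigcup_finite; first by rewrite finite_setU.
  by move=> y yJN; apply: colP => //; case: yJN => -[].
apply: sub_finite_set => g [gB' xg gj gm]; have [Iy By low] := levP g gB'.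
exists (lev g); last by split.
have [ne|] := pselect (below lt I (lev g) !=set0); last by right.
left; split=> //.
have [||//|f Hf fe] := sep g (rst (B (lev g)) x) (rst (lower lt I B (lev g)) x).
- by apply: (pB _ Iy).1.
- by apply: (pl _ Iy ne).1.
- by rewrite rst_in// rst_out.
by exists f; rewrite // -gm.
Qed.

(* D j runs over a partition of A into countable pieces; T j is an iterated
   difference of operators f |-> f \o rst B which turns the evaluation of
   coordinate g into itself if g is in D j and into 0 otherwise. *)
Record pieces (A : set G) (D : seq (universe G) -> set G)
    (T : seq (universe G) -> ((G -> R) -> R) -> (G -> R) -> R) : Prop := {
  pieces_cover : forall g, A g <-> exists j, D j g;
  pieces_disj : forall j j' g, D j g -> D j' g -> j = j';
  pieces_countable : forall j, countable (D j);
  pieces_rst : forall j f x, T j f (rst A x) = T j f x;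
  pieces_lin : forall j (a : R) f h x,
    T j (fun y => a * f y + h y) x = a * T j f x + T j h x;
  pieces_bound : forall j f (C : R), (forall x, Q x -> `|f x| <= C) ->
    forall x, Q x -> `|T j f x| <= 2 ^+ size j * C;
  pieces_coord : forall j g x,
    T j (fun y => y g) x = if `[< D j g >] then x g else 0;
  pieces_contract : forall j x x' (e : R), Q x -> Q x' ->
    (forall k, H k -> `|k x - k x'| <= e) ->
    forall k, H k -> `|T j k x - T j k x'| <= 2 ^+ size j * e;
  pieces_c0 : forall x (e : R), Q x -> 0 < e ->
    finite_set [set j | exists2 k, H k & 2 ^+ size j * e <= `|T j k x|] }.

(** Over a chain, the piece [y :: j] is the part of piece [j] of [B y] that is new at [y], and its
    operator subtracts the effect of restricting to [low y]. Each such difference doubles the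
    bounds, whence the powers of 2. *)
Lemma pieces_exist : exists D T, pieces setT D T.
Proof.
apply: (@projects_ind (fun A => exists D T, pieces A D T)).
  move=> A cA [QA HA].
  exists (fun j => if j is [::] then A else set0).
  exists (fun j f x => if j is [::] then f (rst A x) else 0); split.
  - by move=> g; split=> [Ag|[[|w j]]//]; exists [::].
  - by move=> [|w j] [|w' j'].
  - by move=> [|w j] //=; exact: countable0.
  - by move=> [|w j] f x //; rewrite rst_rstl.
  - by move=> [|w j] a f h x //; rewrite mulr0 addr0.
  - move=> [|w j] f C fC x Qx; first by rewrite expr0 mul1r; apply/fC/QA.
    rewrite normr0 mulr_ge0 ?exprn_ge0//.
    by rewrite (le_trans _ (fC _ Qx)).
  - move=> [|w j] g x; last by rewrite asboolF.
    by rewrite /rst.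
  - move=> [|w j] x x' e Qx Qx' xe k Hk.
      have [h Hh hE] := HA k Hk.
      by rewrite expr0 mul1r -!hE//; apply: xe.
    rewrite subrr normr0 mulr_ge0 ?exprn_ge0//.
    by rewrite (le_trans _ (xe _ Hk)).
  - move=> x e Qx e0; apply: sub_finite_set (finite_set1 [::]) => -[|w j]//= [k _].
    by rewrite normr0 leNgt mulr_gt0// exprn_gt0.
move=> lt I B wf tot pB gB mB pl.
have /choice[D /choice[T DT]] : forall y, exists D, exists T, I y -> pieces (B y) D T.
  move=> y; have [/gB[D [T DT]]|N] := pselect (I y); first by exists D, T.
  by exists (fun=> set0), (fun _ _ _ => 0).
pose low := lower lt I B.
pose D' (j : seq (universe G)) : set G :=
  if j is y :: j then [set g | [/\ I y, D y j g & ~ low y g]] else set0.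
(* With nothing below [y] the set [low y] is empty, and restriction to it need not map [Q] into
   itself; the subtracted term is then set to 0. *)
pose Tlow y j f x : R :=
  if `[< below lt I y !=set0 >] then T y j f (rst (low y) x) else 0.
pose T' (j : seq (universe G)) f x : R :=
  if j is y :: j then
    if `[< I y >] then T y j f x - Tlow y j f x else 0 else 0.
have lowB y : I y -> low y `<=` B y by exact: lower_sub.
have Qlow y x : I y -> below lt I y !=set0 -> Q x -> Q (rst (low y) x).
  by move=> Iy ne; apply: (pl y Iy ne).1.
exists D', T'; split.
- move=> g; split=> [/(ex_level wf)[y [Iy By gl]]|[[|y j]//= [Iy Dg _]]].
    have [j Dj] := (pieces_cover (DT y Iy) g).1 By.
    by exists (y :: j).
  by exists y => //; apply/(pieces_cover (DT y Iy)); exists j.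
- move=> [|y j] [|y' j'] g //= [Iy Dg gl] [Iy' Dg' gl'].
  have Bg : B y g by apply/(pieces_cover (DT y Iy)); exists j.
  have Bg' : B y' g by apply/(pieces_cover (DT y' Iy')); exists j'.
  have yy : y = y'.
    have [yy'|//|y'y] := tot y y'.
      by case: gl'; exists y.
    by case: gl; exists y'.
  by subst y'; rewrite (pieces_disj (DT y Iy) Dg Dg').
- move=> [|y j] /=; first exact: countable0.
  have [Iy|Iy] := pselect (I y); last first.
    by rewrite (_ : [set _ | _] = set0)//; apply/seteqP; split=> g // [].
  apply: sub_countable (pieces_countable (DT y Iy) j).
  by apply: subset_card_le => g [].
- move=> [|y j] f x //=; case: asboolP => // Iy.
  have BU : B y `<=` \bigcup_(y in I) B y by move=> g Bg; exists y.
  rewrite -(pieces_rst (DT y Iy)) rst_rstl// (pieces_rst (DT y Iy)).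
  rewrite /Tlow; case: asboolP => // ne; rewrite rst_rstl//.
  exact: subset_trans (lowB _ Iy) BU.
- move=> [|y j] a f h x /=; first by rewrite mulr0 addr0.
  case: asboolP => Iy; last by rewrite mulr0 addr0.
  rewrite /Tlow; case: asboolP => ne; rewrite !(pieces_lin (DT y Iy)).
    by rewrite mulrBr opprD addrACA.
  by rewrite !subr0.
- move=> [|y j] f C fC x Qx /=.
    by rewrite normr0 expr0 mul1r (le_trans _ (fC _ Qx)).
  have C0 : 0 <= C by rewrite (le_trans _ (fC _ Qx)).
  case: asboolP => Iy; last by rewrite normr0 mulr_ge0// exprn_ge0.
  have bd := pieces_bound (DT y Iy) j fC.
  rewrite (le_trans (ler_normB _ _))// exprS -mulrA mulr_natl mulr2n lerD ?bd//.
  rewrite /Tlow; case: asboolP => ne; first exact/bd/Qlow.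
  by rewrite normr0 mulr_ge0// exprn_ge0.
- move=> [|y j] g x /=; first by rewrite asboolF.
  case: asboolP => Iy; last by rewrite asboolF// => -[].
  rewrite /Tlow !(pieces_coord (DT y Iy)).
  case: (asboolP (D y j g)) => Dg; last first.
    by rewrite if_same subr0 asboolF// => -[].
  have [gl|gl] := pselect (low y g).
    rewrite asboolT; last by case: gl => z zb _; exists z.
    by rewrite rst_in// subrr asboolF// => -[].
  rewrite rst_out// if_same subr0 asboolT//.
- move=> [|y j] x x' e Qx Qx' xe k Hk /=.
    by rewrite subrr normr0 expr0 mul1r (le_trans _ (xe _ Hk)).
  have e0 : 0 <= e by rewrite (le_trans _ (xe _ Hk)).
  case: asboolP => Iy; last by rewrite subrr normr0 mulr_ge0// exprn_ge0.
  have ct := pieces_contract (DT y Iy) j.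
  rewrite opprD addrACA -opprD (le_trans (ler_normB _ _))//.
  rewrite exprS -mulrA mulr_natl mulr2n lerD//; first by apply: ct.
  rewrite /Tlow; case: asboolP => ne; last first.
    by rewrite subrr normr0 mulr_ge0// exprn_ge0.
  apply: ct => //; try exact: Qlow.
  move=> h Hh; have [h' Hh' h'E] := (pl y Iy ne).2 _ Hh.
  by rewrite -!h'E//; apply: xe.
- move=> x e Qx e0.
  have fJ := finite_jumps cQ H_cont H_compact wf tot pB mB pl Qx e0.
  have fM := finite_minimal I tot.
  set J := [set y | _] in fJ; set N := [set y | _] in fM.
  pose S y z := [set j | exists2 k, H k & 2 ^+ size j * e <= `|T y j k z|].
  have fS y z : I y -> Q z -> finite_set (S y z).
    by move=> Iy Qz; apply: (pieces_c0 (DT y Iy)).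
  have : finite_set (\bigcup_(y in J `|` N) (cons y @` (S y x `|`
      if `[< below lt I y !=set0 >] then S y (rst (low y) x) else set0))).
    apply: bigcup_finite; first by rewrite finite_setU.
    move=> y yJN; have Iy : I y by case: yJN => -[].
    apply: finite_image; rewrite finite_setU; split; first exact: fS.
    case: asboolP => // ne; apply: fS => //; exact: Qlow.
  apply: sub_finite_set => -[|y j] [k Hk] /=.
    by rewrite normr0 expr0 mul1r leNgt e0.
  case: asboolP => Iy; last first.
    by rewrite normr0 leNgt mulr_gt0// exprn_gt0.
  rewrite /Tlow exprS -mulrA mulr_natl mulr2n => big.
  have e2 : 0 < 2 ^+ size j * e by rewrite mulr_gt0// exprn_gt0.
  exists y.
    have [ne|] := pselect (below lt I y !=set0); last by right.
    (* Without a jump at [y], contraction bounds the difference by [2 ^+ size j * e], half of what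
       [big] requires. *)
    left; split=> //; apply: contrapT => NJ; move: big; rewrite asboolT//.
    rewrite -(pieces_rst (DT y Iy)) leNgt => /negP; apply.
    apply: (@le_lt_trans _ _ (2 ^+ size j * e)); last by rewrite ltrDl.
    apply: (pieces_contract (DT y Iy)) => //; first exact: (pB y Iy).1.
      exact: Qlow.
    move=> h Hh; rewrite leNgt; apply/negP => he; apply: NJ.
    by exists h => //; rewrite ltW.
  exists j => //; move: big; case: asboolP => ne big; last first.
    by rewrite subr0 in big; left; exists k; rewrite // (le_trans _ big)// lerDl ltW.
  (* One of the two terms carries at least half of the bound, so [j] is among the finitely many
     large pieces of [x] or of [rst (low y) x]. *)
  have [h|h] := leP (2 ^+ size j * e) `|T y j k x|; first by left; exists k.
  right; exists k => //; rewrite leNgt; apply/negP => h'.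
  move: big; apply/negP; rewrite -ltNge (le_lt_trans (ler_normB _ _))//.
  exact: ltrD.
Qed.

End Decompositions.

(** * Eberlein compact sets *)

Lemma bounded_ulim (I : Type) (U : set_system I) (u : I -> R) (C : R) :
  UltraFilter U -> (forall i, `|u i| <= C) -> exists l, ulim U u l.
Proof.
move=> UU uC; pose A := [set r | U [set i | r <= u i]].
have sA : has_sup A.
  split; first exists (- C).
    by apply: filterS filterT => i _ /=; move: (uC i); rewrite ler_norml => /andP[].
  exists C => r rA; have [i /= ri] := ultra_ex UU rA.
  by rewrite (le_trans ri)// (le_trans (ler_norm _)).
exists (sup A) => e e0.
have [r rA er] := sup_adherent e0 sA.
have [h|h] := in_ultra_setVsetC [set i | sup A + e / 2 <= u i] UU.
  have := ub_le_sup sA.2 h; rewrite leNgt => /negP; case.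
  by rewrite ltrDl divr_gt0.
apply: filterS2 rA h => i /= ri /negP; rewrite -ltNge => ui.
rewrite ltr_distl (lt_le_trans er ri) /=.
by rewrite (lt_trans ui)// ltrD2l ltr_pdivrMr// ltr_pMr// ltr1n.
Qed.

Section EberleinCompact.
Variables (G : Type) (K : set (G -> R)).
Hypothesis EK : Eberlein_compact K.

Lemma Eberlein_ucompact : ucompact (@coords G) K.
Proof.
have [E [W [h [k [cW [Kh [Wk [_ kc]]]]]]]] := EK.
move=> I U x UU Kx.
have [w Ww wP] := Fcompact_ucompact cW UU (fun i => (Kh _ (Kx i)).1).
exists (k w) => [|f Ff]; first by case: (Wk w Ww).
have := Fcont_ulim UU kc (fun i => (Kh _ (Kx i)).1) Ww wP Ff.
move=> /(ulim_near UU); apply; apply: filterS filterT => i _ /=.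
by case: (Kh _ (Kx i)) => _ ->.
Qed.

Hypothesis K_countable : forall x, K x -> countable [set g | x g <> 0].
Hypothesis K01 : forall x g, K x -> x g = 0 \/ x g = 1.

(* The unit ball of E*, transported to K, is a pointwise compact set of
   continuous functions; each coordinate is uniformly separated by it. *)
Lemma Eberlein_colouring : exists col : G -> nat, forall x j, K x ->
  finite_set [set g | x g <> 0 /\ col g = j].
Proof.
have cK := Eberlein_ucompact.
have [E [W [h [k [cW [Kh [Wk [hc kc]]]]]]]] := EK.
have uW := Fcompact_ucompact cW.
pose dual := dual_on (fun x : E => `|x|) setT.
pose ball := [set f : E -> R | lin_on (W := R^o) setT f /\ forall y, `|f y| <= `|y|].
have ball_dual f : ball f -> dual f.
  by move=> [lf bf]; split=> //; exists 1 => y _; rewrite mul1r.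
pose H := [set (f \o h : (G -> R) -> R) | f in ball].
have Hc f : H f -> ucont K f.
  move=> [F /ball_dual bF <-] I U x l UU Kx Kl xl /=.
  apply: (Fcont_ulim UU hc Kx Kl _ bF).
  by move=> _ [g _ <-]; apply: xl.
(* Banach-Alaoglu: the pointwise limit along [U] of functionals in the unit ball is again one. *)
have Hk : ucompact [set ev | exists2 x, K x & ev = fun f => f x] H.
  move=> I U f UU Hf.
  have /choice[F FP] : forall i, exists F, ball F /\ F \o h = f i.
    by move=> i; have [F] := Hf i; exists F.
  have /choice[phi phiP] : forall v : E, exists l, ulim U (fun i => F i v) l.
    by move=> v; apply: (bounded_ulim (C := `|v|)) => i; exact: (FP i).1.2.
  exists (phi \o h); last first.
    move=> _ [x Kx ->] /=; apply: (ulim_near UU (phiP (h x))).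
    by apply: filterS filterT => i _ /=; rewrite -(FP i).2.
  exists phi => //; split.
    move=> a x y _ _; apply: (ulim_uniq UU (phiP _)).
    have := ulim_lin UU a (phiP y) (phiP x); rewrite addrC.
    move=> /(ulim_near UU); apply.
    apply: filterS filterT => i _ /=.
    by rewrite (FP i).1.1// addrC.
  move=> y; apply: (ulim_le UU (ulim_norm UU (phiP y))).
  by apply: filterS filterT => i _ /=; exact: (FP i).1.2.
(* Otherwise pairs of points differing by 1 at [g] would become indistinguishable for the unit ball;
   their weak limits [w] and [v] would agree under every functional and yet differ by 1 at [g]. *)
have sep g : exists m : nat, forall x y, K x -> K y -> x g <> y g ->
    exists2 f, H f & m.+1%:R^-1 <= `|f x - f y|.
  apply: contrapT => N.
  have /choice[z zP] : forall m : nat, exists z : (G -> R) * (G -> R),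
      [/\ K z.1, K z.2, z.1 g <> z.2 g &
          forall f, H f -> `|f z.1 - f z.2| < m.+1%:R^-1].
    move=> m; apply: contrapT => Nm; apply: N; exists m => x y Kx Ky xy.
    apply: contrapT => Nf; apply: Nm; exists (x, y); split=> // f Hf.
    by rewrite ltNge; apply/negP => fm; apply: Nf; exists f.
  have [U [UU Um]] := nat_ultra.
  have K1 m : K (z m).1 by case: (zP m).
  have K2 m : K (z m).2 by case: (zP m).
  have [w Ww wP] := uW _ _ _ UU (fun i => (Kh _ (K1 i)).1).
  have [v Wv vP] := uW _ _ _ UU (fun i => (Kh _ (K2 i)).1).
  have gco : coords (fun x : G -> R => x g) by exists g.
  have h1 := Fcont_ulim UU kc (fun i => (Kh _ (K1 i)).1) Ww wP gco.
  have h2 := Fcont_ulim UU kc (fun i => (Kh _ (K2 i)).1) Wv vP gco.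
  have kk : `|k v g - k w g| = 1.
    rewrite distrC; apply: (ulim_uniq UU (ulim_norm UU (ulimB UU h1 h2))).
    apply: (ulim_near UU (ulim_cst UU 1)); apply: filterS filterT => m _ /=.
    rewrite (Kh _ (K1 m)).2 (Kh _ (K2 m)).2.
    have [_ _ + _] := zP m.
    have [->|->] := K01 g (K1 m); have [->|->] := K01 g (K2 m) => //.
      by rewrite sub0r normrN normr1.
    by rewrite subr0 normr1.
  have fwv f : dual f -> f v = f w.
    move=> df; have [lf [C fC]] := df.
    have C0 : 0 < `|C| + 1 by rewrite ltr_wpDl.
    pose F := fun y => (`|C| + 1)^-1 * f y.
    have bF : ball F.
      split=> [a x y _ _|y]; first by rewrite /F lf// mulrDr /GRing.scale/= mulrCA.
      rewrite /F normrM gtr0_norm ?invr_gt0// mulrC ler_pdivrMr// mulrC.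
      rewrite (le_trans (fC y I))// ler_wpM2r//.
      by rewrite (le_trans (ler_norm _))// lerDl.
    have HF : H (F \o h) by exists F.
    have dF := ball_dual _ bF.
    have d0 := ulim_norm UU (ulimB UU (vP _ dF) (wP _ dF)).
    have : `|F v - F w| = 0.
      apply: (ulim_uniq UU d0) => e e0.
      pose m := Num.bound (e^-1).
      apply: filterS (Um m) => i mi /=.
      have [_ _ _ /(_ _ HF) /=] := zP i; rewrite distrC subr0 normr_id => /lt_trans.
      apply; rewrite invf_plt ?posrE//.
      apply: lt_le_trans (archi_boundP _) _; first by rewrite invr_ge0 ltW.
      by rewrite ler_nat (leq_trans mi).
    move/eqP; rewrite normr_eq0 /F -mulrBr mulf_eq0 invr_eq0 gt_eqF//=.
    by rewrite subr_eq0 => /eqP.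
  have e0 : 0 < 2^-1 :> R by rewrite invr_gt0.
  (* [v] lies in every weak neighbourhood of [w], so continuity of [k] at [w] puts the two values at
     [g] within [1/2]. *)
  have [n [fs [Ffs [d [d0 dP]]]]] := kc w Ww _ gco _ e0.
  have := dP v Wv; rewrite kk => hlt.
  have : (1 : R) < 2^-1.
    by apply: hlt => i; rewrite fwv ?subrr ?normr0//; exact: Ffs.
  by rewrite invf_gt1// ltNge ler1n.
have /choice[mm mmP] := sep.
exact: (colouring cK K_countable Hc Hk mmP).
Qed.

End EberleinCompact.

(** * The space X *)

Lemma ucompact_sub (A : Type) (F F' : set (A -> R)) (K : set A) :
  F' `<=` F -> ucompact F K -> ucompact F' K.
Proof.
move=> FF cK I U x UU Kx; have [l Kl lP] := cK I U x UU Kx.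
by exists l => // f /FF; exact: lP.
Qed.

Section SupNorm.
Variables (G : Type) (K : set (G -> R)).
Hypothesis K0 : K !=set0.

Lemma le_supnorm (f : FS G) (C : R) x :
  (forall y, K y -> `|f y| <= C) -> K x -> `|f x| <= supnorm K f.
Proof.
move=> fC Kx; apply: ub_le_sup; last by exists x.
by exists C => _ [y Ky <-]; exact: fC.
Qed.

Lemma supnorm_le (f : FS G) (C : R) :
  (forall y, K y -> `|f y| <= C) -> supnorm K f <= C.
Proof.
move=> fC; apply: ge_sup; first by have [x Kx] := K0; exists `|f x|, x.
by move=> _ [y Ky <-]; exact: fC.
Qed.

Lemma CK_ucont (f : FS G) : CK K f -> ucont K f.
Proof.
move=> [_ fc] I U x l UU Kx Kl xl.
apply: (Fcont_ulim (g := id) UU fc Kx Kl) => //.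
by move=> _ [g _ <-]; exact: xl.
Qed.

Lemma e_coord_in (g : G) x : K x -> e_coord K g x = x g.
Proof. by move=> Kx; rewrite /e_coord indicE mem_set// mul1r. Qed.

Lemma CK_e_coord g : CK K (e_coord K g).
Proof.
split=> [x Kx|x Kx _ -> e e0]; first by rewrite /e_coord indicE memNset// mul0r.
exists 1%N, (fun _ x => x g); split=> [_|]; first by exists g.
by exists e; split=> // y Ky /(_ ord0); rewrite !e_coord_in.
Qed.

Lemma sum_e_coord n (c : 'I_n -> R) (gs : 'I_n -> G) x : K x ->
  (\sum_(i < n) c i *: e_coord K (gs i)) x = \sum_(i < n) c i * x (gs i).
Proof.
by move=> Kx; rewrite fct_sumE; apply: eq_bigr => i _; rewrite -e_coord_in.
Qed.

Hypotheses (cK : ucompact (@coords G) K)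
  (K1 : forall x g, K x -> `|x g| <= 1).

Lemma X_bounded f : Xspace K f -> exists C, forall x, K x -> `|f x| <= C.
Proof. by move=> [/CK_ucont fc _]; apply: ucont_bounded. Qed.

Lemma X_le_supnorm f x : Xspace K f -> K x -> `|f x| <= supnorm K f.
Proof. by move=> /X_bounded[C fC]; apply: le_supnorm fC. Qed.

Lemma X_approx f (e : R) : Xspace K f -> 0 < e -> exists l : seq (R * G),
  forall x, K x -> `|f x - \sum_(p <- l) p.1 * x p.2| <= e.
Proof.
move=> Xf e0; have [n [c [gs h]]] := Xf.2 e e0.
exists [seq (c i, gs i) | i <- enum 'I_n] => x Kx.
rewrite big_map big_enum/= -sum_e_coord//.
apply: le_trans (ltW h).
have [C fC] := X_bounded Xf.
apply: (@le_supnorm _ (C + \sum_(i < n) `|c i|)) => // y Ky.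
rewrite (le_trans (ler_normB _ _))// lerD ?fC// sum_e_coord//.
rewrite (le_trans (ler_norm_sum _ _ _))// ler_sum// => i _.
by rewrite normrM ler_piMr// K1.
Qed.

Lemma X_e_coord g : Xspace K (e_coord K g).
Proof.
split=> [|e e0]; first exact: CK_e_coord.
exists 1%N, (fun=> 1), (fun=> g); rewrite big_ord1 scale1r subrr.
apply: le_lt_trans e0; apply: supnorm_le => y Ky.
by rewrite normr0.
Qed.

Lemma X_eval_dual x : K x -> dual_on (supnorm K) (Xspace K) (fun f : FS G => f x).
Proof.
move=> Kx; split=> [//|]; exists 1 => f Xf.
by rewrite mul1r; exact: X_le_supnorm.
Qed.

Lemma eq0_small (a C : R) : (forall e : R, 0 < e -> `|a| <= C * e) -> a = 0.
Proof.
move=> aC; apply/eqP; rewrite -normr_le0 leNgt; apply/negP => a0.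
have C0 : 0 < C by rewrite -[C]mulr1 (lt_le_trans a0)// aC.
have := aC (`|a| / (C * 2)); rewrite divr_gt0// ?mulr_gt0// => /(_ isT).
have -> : C * (`|a| / (C * 2)) = `|a| / 2 by field; rewrite gt_eqF.
by move=> h; lra.
Qed.

Hypothesis K_countable : forall x, K x -> countable [set g | x g <> 0].

Section WeaklyCompact.
Variable L : set (FS G).
Hypotheses (cL : weakly_compact_in (supnorm K) (Xspace K) L)
  (sL : span_dense_in (supnorm K) (Xspace K) L).

(** Evaluations at points of [K] are bounded functionals on X, so a weakly compact set is pointwise
    compact on [K]. *)
Lemma L_pieces : exists D T, pieces K (L : set ((G -> R) -> R)) setT D T.
Proof.
have LX := cL.1.
apply: pieces_exist => //; first by move=> f /LX[/CK_ucont].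
apply: ucompact_sub (Fcompact_ucompact cL) => _ [x Kx ->].
exact: X_eval_dual.
Qed.

Lemma L_total x g : K x -> x g != 0 -> exists2 k, L k & k x != 0.
Proof.
move=> Kx xg; apply: contrapT => N.
have Lx k : L k -> k x = 0.
  by move=> Lk; apply: contrapT => /eqP kx; apply: N; exists k.
have xg0 : 0 < `|x g| by rewrite normr_gt0.
have [n [c [k [Lk]]]] := sL (X_e_coord g) xg0.
apply/negP; rewrite -leNgt.
have /choice[C CP] : forall i, exists C, forall y, K y -> `|k i y| <= C.
  by move=> i; apply/X_bounded/cL.1.
have -> : `|x g| = `|(e_coord K g - \sum_(i < n) c i *: k i) x|.
  rewrite /GRing.add/= /GRing.opp/= fct_sumE e_coord_in// big1 ?subr0// => i _.
  by rewrite -[LHS]/(c i * k i x) Lx// mulr0.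
apply: (@le_supnorm _ (1 + \sum_(i < n) `|c i| * C i)) => // y Ky.
rewrite (le_trans (ler_normB _ _))// lerD//.
  by rewrite e_coord_in// K1.
rewrite fct_sumE (le_trans (ler_norm_sum _ _ _))// ler_sum// => i _.
by rewrite -[X in `|X|]/(c i * k i y) normrM ler_wpM2l// CP.
Qed.

(** The identity holds on coordinates by hypothesis, on finite combinations by linearity, and on X
    by approximation, the bound for [T j] controlling the error. *)
Lemma pieces_eval (H : set ((G -> R) -> R)) D T j f x y (b : R) :
  pieces K H setT D T -> Xspace K f -> K x -> K y ->
  (forall g, (if `[< D j g >] then x g else 0) = b * y g) ->
  T j f x = b * f y.
Proof.
move=> DT Xf Kx Ky xy; apply/eqP; rewrite -subr_eq0; apply/eqP.
apply: (@eq0_small _ (2 ^+ size j + `|b|)) => e e0.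
have [l lP] := X_approx Xf e0.
pose p (z : G -> R) := \sum_(p <- l) p.1 * z p.2.
have Tp : T j p x = b * p y.
  rewrite /p; elim: (l) => [|[a g] s IH].
    rewrite big_nil mulr0; apply/eqP; rewrite -normr_le0.
    rewrite -[leRHS](mulr0 (2 ^+ size j)).
    by apply: (pieces_bound DT) => // z _; rewrite big_nil normr0.
  under [X in T j X]funext => z do rewrite big_cons.
  by rewrite (pieces_lin DT) (pieces_coord DT) IH xy big_cons mulrDr mulrCA.
have -> : T j f x - b * f y =
    (T j (fun z => -1 * p z + f z) x) - b * (f y - p y).
  by rewrite (pieces_lin DT) Tp mulrBr mulN1r opprB addrACA addNr add0r addrC.
rewrite (le_trans (ler_normB _ _))// mulrDl lerD//.
  by apply: (pieces_bound DT) => // z Kz; rewrite mulN1r addrC; apply: lP.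
by rewrite normrM ler_wpM2l//; apply: lP.
Qed.

End WeaklyCompact.
End SupNorm.

(** * X is not weakly compactly generated *)

Section QuasiEberlein.
Variables (G : Type) (S : set (set G)) (Sn : nat -> set (set G)).
Hypothesis qE : quasi_Eberlein S Sn.

Let SE := Eberleinization Sn.
Let layer n : set (G -> R) := [set chi s | s in Sn n].

Lemma chi_in (s : set G) g : s g -> chi s g = 1.
Proof. by move=> sg; rewrite /chi indicE mem_set. Qed.

Lemma chi_out (s : set G) g : ~ s g -> chi s g = 0.
Proof. by move=> sg; rewrite /chi indicE memNset. Qed.

Lemma chi01 (s : set G) g : chi s g = 0 \/ chi s g = 1.
Proof.
by have [sg|sg] := pselect (s g); [right; exact: chi_in|left; exact: chi_out].
Qed.

Lemma chi_neq0 (s : set G) g : chi s g <> 0 -> s g.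
Proof. by move=> h; apply: contrapT => /chi_out. Qed.

Lemma Sn_sub n s : Sn n s -> S s.
Proof. by case: qE => _ [_ [_ [_ [-> _]]]] ns; exists n. Qed.

Lemma Sn_countable n s : Sn n s -> countable s.
Proof. by move=> /Sn_sub; case: qE => + _; apply. Qed.

Lemma layer_Eberlein n : Eberlein_compact (layer n).
Proof. by case: qE => _ [_ [_ [_ [_ [+ _]]]]]; apply. Qed.

Lemma Sn_singleton g : Sn 0%N [set g].
Proof. by case: qE => _ [_ [_ [_ [_ [_ [+ _]]]]]]; apply. Qed.

Lemma layer_countable n x : layer n x -> countable [set g | x g <> 0].
Proof.
move=> [s /Sn_countable cs <-]; apply: sub_countable cs.
by apply: subset_card_le => g /chi_neq0.
Qed.

Lemma layer01 n x g : layer n x -> x g = 0 \/ x g = 1.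
Proof. by move=> [s _ <-]; exact: chi01. Qed.

Lemma SEP n s : Sn n s -> SE (fun g => n.+1%:R^-1 * chi s g).
Proof. by move=> ns; exists n, s. Qed.

Lemma SE_singleton g : SE (chi [set g]).
Proof.
exists 0%N, [set g]; split; first exact: Sn_singleton.
by apply/funext => h; rewrite invr1 mul1r.
Qed.

Lemma SE_bound x g : SE x -> `|x g| <= 1.
Proof.
move=> [n [s [_ ->]]]; rewrite normrM ger0_norm ?invr_ge0//.
have n1 : n.+1%:R^-1 <= 1 :> R by rewrite invf_le1// ler1n.
by have [->|->] := chi01 s g; rewrite ?normr0 ?mulr0// normr1 mulr1.
Qed.

Lemma SE_countable x : SE x -> countable [set g | x g <> 0].
Proof.
move=> [n [s [/Sn_countable cs ->]]]; apply: sub_countable cs.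
apply: subset_card_le => g /= h; apply: chi_neq0 => sg.
by apply: h; rewrite sg mulr0.
Qed.

Lemma carrier_infinite : infinite_set [set: G].
Proof.
move=> fG; have [_ [_ [_ [_ [_ [_ [_ q]]]]]]] := qE.
have h1 (D : set G) : [set setT] D -> countable D.
  by move=> ->; exact: finite_set_countable.
have h2 (D D' : set G) : [set setT] D -> [set setT] D' -> D <> D' -> D `&` D' = set0.
  by move=> -> ->.
have h3 (g : G) : exists D, [set setT] D /\ D g by exists setT.
pose Gn n : set G := if n is 0%N then setT else set0.
have h4 m n : m <> n -> Gn m `&` Gn n = set0.
  by case: m n => [|m] [|n] //= _; rewrite ?setI0 ?set0I.
have h5 g : exists n, Gn n g by exists 0%N.
have [s [n [_ [h _]]]] := q [set setT] h1 h2 h3 Gn h4 h5.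
by apply: h; exact: sub_finite_set fG.
Qed.

(** Singletons of distinct points converge pointwise to the empty set, and the first layer is
    compact. *)
Lemma Sn0_set0 : Sn 0%N set0.
Proof.
have [f [f_inj _]] := infinite_injection carrier_infinite.
have [U [UU Um]] := nat_ultra.
have lf i : layer 0 (chi [set f i]).
  by exists [set f i] => //; exact: Sn_singleton.
have [x [s Ss sx] xP] := Qlimit (Eberlein_ucompact (layer_Eberlein 0)) UU lf.
suff -> : set0 = s by [].
apply/seteqP; split=> // g sg.
have : chi s g = 0; last by rewrite chi_in// => /eqP; rewrite oner_eq0.
rewrite sx; apply: (ulim_uniq UU (xP g)).
apply: (ulim_near UU (ulim_cst UU 0)).
have [[n fn]|N] := pselect (exists n, f n = g).
  apply: filterS (Um n.+1) => i /= ni; rewrite chi_out// => /= gi.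
  have : i = n by apply: f_inj; rewrite fn -gi.
  by move=> e; rewrite e ltnn in ni.
apply: filterS filterT => i _ /=; rewrite chi_out// => /= gi.
by apply: N; exists i.
Qed.

Lemma SE0 : SE (fun=> 0).
Proof.
exists 0%N, set0; split; first exact: Sn0_set0.
by apply/funext => g; rewrite chi_out// mulr0.
Qed.

(** Along [U] the layer number is either constant, and that layer is compact, or unbounded, and the
    factor [1/(n+1)] forces the limit 0, which lies in [SE] thanks to the empty set. *)
Lemma SE_ucompact : ucompact (@coords G) SE.
Proof.
move=> I U x UU Kx.
have /choice[p pP] : forall i, exists p : nat * set G,
    Sn p.1 p.2 /\ x i = (fun g => p.1.+1%:R^-1 * chi p.2 g).
  by move=> i; have [n [s ns]] := Kx i; exists (n, s).
have [[n Un]|N] := pselect (exists n, U [set i | (p i).1 = n]).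
  have [i0 i0n] := ultra_ex UU Un.
  (* Terms outside layer [n] are replaced by a fixed point of it; this changes nothing along [U]. *)
  have /choice[y yP] : forall i, exists y, layer n y /\ ((p i).1 = n -> y = chi (p i).2).
    move=> i; have [<-|ne] := pselect ((p i).1 = n).
      by exists (chi (p i).2); split=> //; exists (p i).2 => //; case: (pP i).
    by exists (chi (p i0).2); split=> //; exists (p i0).2 => //; rewrite -i0n; case: (pP i0).
  have [z [s ns sz] zP] :=
    Qlimit (Eberlein_ucompact (layer_Eberlein n)) UU (fun i => (yP i).1).
  exists (fun g => n.+1%:R^-1 * chi s g); first exact: SEP.
  move=> _ [g _ <-] /=.
  have := ulim_lin UU n.+1%:R^-1 (ulim_cst UU 0) (zP g).
  rewrite add0r -sz => /(ulim_near UU); apply; apply: filterS Un => i /= ni.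
  by rewrite add0r (yP i).2// (pP i).2 ni.
have big n : U [set i | (n <= (p i).1)%N].
  elim: n => [|n IH]; first by apply: filterS filterT.
  have [h|h] := in_ultra_setVsetC [set i | (p i).1 = n] UU; first by case: N; exists n.
  by apply: filterS2 IH h => i /=; rewrite leq_eqVlt => /orP[/eqP->|].
exists (fun=> 0); first exact: SE0.
move=> _ [g _ <-] e e0; pose n := Num.bound e^-1.
apply: filterS (big n) => i /= ni; rewrite subr0 (pP i).2 normrM.
rewrite ger0_norm ?invr_ge0//.
apply: (@le_lt_trans _ _ (p i).1.+1%:R^-1).
  rewrite ler_piMr ?invr_ge0//.
  by have [->|->] := chi01 (p i).2 g; rewrite ?normr0 ?normr1.
rewrite invf_plt ?posrE//.
apply: lt_le_trans (archi_boundP _) _; first by rewrite invr_ge0 ltW.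
by rewrite ler_nat (leq_trans ni).
Qed.

Lemma SE_neq0 : SE !=set0.
Proof. by exists (fun=> 0); exact: SE0. Qed.

Lemma not_WCG : ~ WCG_in (supnorm SE) (Xspace SE).
Proof.
move=> [L [cL sL]].
have [D [T DT]] := L_pieces SE_ucompact SE_countable cL.
have /choice[k kP] : forall g, exists k : FS G, L k /\ k (chi [set g]) != 0.
  move=> g; have := L_total SE_neq0 SE_ucompact SE_bound cL sL (SE_singleton g).
  move=> /(_ g); rewrite chi_in// oner_eq0 => /(_ isT)[k Lk kg].
  by exists k.
have /choice[j jP] : forall g, exists j, D j g.
  by move=> g; apply/(pieces_cover DT).
(* The colour of [g] records the size of [k g] at its singleton relative to the factor
   [2 ^+ size (j g)] of its piece, to match the threshold in [pieces_c0]. *)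
have /choice[m mP] : forall g, exists m : nat,
    2 ^+ size (j g) * m.+1%:R^-1 <= `|k g (chi [set g])|.
  move=> g; have kg : 0 < `|k g (chi [set g])| by rewrite normr_gt0 (kP g).2.
  pose a := `|k g (chi [set g])| / 2 ^+ size (j g).
  have a0 : 0 < a by rewrite divr_gt0// exprn_gt0.
  exists (Num.bound a^-1).
  rewrite mulrC -ler_pdivlMr ?exprn_gt0// -/a invf_ple ?posrE//.
  apply: le_trans (ltW (archi_boundP _)) _; first by rewrite invr_ge0 ltW.
  by rewrite ler_nat.
have [_ [_ [_ [_ [SU [_ [_ q]]]]]]] := qE.
have h1 D0 : range D D0 -> countable D0.
  by move=> [i _ <-]; exact: (pieces_countable DT).
have h2 D0 D1 : range D D0 -> range D D1 -> D0 <> D1 -> D0 `&` D1 = set0.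
  move=> [i _ <-] [i' _ <-] ne; apply/seteqP; split=> // g [gi gi'].
  by apply: ne; rewrite (pieces_disj DT gi gi').
have h3 g : exists D0, range D D0 /\ D0 g.
  by exists (D (j g)); split=> //; exists (j g).
pose Gn n := [set g | m g = n].
have h4 n n' : n <> n' -> Gn n `&` Gn n' = set0.
  by move=> ne; apply/seteqP; split=> // g [gn gn']; apply: ne; rewrite -gn.
have h5 g : exists n, Gn n g by exists (m g).
have [s [n0 [Ss [sinf s1]]]] := q _ h1 h2 h3 Gn h4 h5.
have [N _ Ns] : (\bigcup_n Sn n) s by rewrite -SU.
pose x : G -> R := fun g => N.+1%:R^-1 * chi s g.
have SEx : SE x by exact: SEP.
pose e : R := N.+1%:R^-1 * n0.+1%:R^-1.
have e0 : 0 < e by rewrite mulr_gt0// invr_gt0.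
apply: sinf; have := pieces_c0 DT SEx e0; set J := [set j | _] => fJ.
(* [s] has at most one point in each piece, so finitely many large pieces capture only finitely many
   points of colour [n0]. *)
have : finite_set (\bigcup_(i in J) ((s `&` Gn n0) `&` D i)).
  apply: bigcup_finite => // i _.
  have [[g [[sg _] Dg]]|none] := pselect (((s `&` Gn n0) `&` D i) !=set0).
    apply: sub_finite_set (finite_set1 g) => h [[sh _] Dh].
    by apply: (s1 (D i)) => //; exists i.
  rewrite (_ : _ `&` _ = set0)//; apply/seteqP; split=> // g hg.
  by apply: none; exists g.
apply: sub_finite_set => g [sg gn]; exists (j g); last by split.
exists (k g); first by case: (kP g).
(* Inside the piece of [g] the set [s] reduces to [g], so there [x] is the singleton's indicator
   divided by [N.+1]. *)
have -> : T (j g) (k g) x = N.+1%:R^-1 * k g (chi [set g]).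
  apply: (pieces_eval SE_ucompact SE_bound DT) => //.
  - by apply: cL.1; case: (kP g).
  - exact: SE_singleton.
  move=> h; rewrite /x; case: asboolP => Dh.
    have [<-|gh] := pselect (g = h); first by rewrite !chi_in.
    rewrite [chi [set g] h]chi_out; last by move=> /esym.
    rewrite chi_out ?mulr0// => sh; by apply: gh; apply: (s1 (D (j g))).
  by rewrite [chi [set g] h]chi_out ?mulr0// => hg; apply: Dh; rewrite hg.
rewrite normrM ger0_norm ?invr_ge0// /e mulrCA ler_wpM2l ?invr_ge0//.
by have := mP g; rewrite gn.
Qed.

End QuasiEberlein.

(** * Convex combinations (Ptak) *)

Section ConvexCombinations.
Variables (V : lmodType R) (T : Type) (ev : V -> T -> R) (a : nat -> V).
Hypotheses (ev_lin : forall c u v t, ev (c *: u + v) t = c * ev u t + ev v t)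
  (a01 : forall i t, ev (a i) t = 0 \/ ev (a i) t = 1).

Inductive hull (A : set V) : set V :=
| hull_in u : A u -> hull A u
| hull_mix (c : R) u v : 0 <= c -> c <= 1 -> hull A u -> hull A v ->
    hull A (c *: u + (1 - c) *: v).

Lemma hull_sub (A B : set V) : A `<=` hull B -> hull A `<=` hull B.
Proof.
move=> AB u; elim=> [{}u /AB//|c {}u v c0 c1 _ hu _ hv].
exact: hull_mix.
Qed.

Lemma hull_mono (A B : set V) : A `<=` B -> hull A `<=` hull B.
Proof. by move=> AB; apply: hull_sub => u /AB; exact: hull_in. Qed.

Lemma ev_mix c u v t : ev (c *: u + (1 - c) *: v) t = c * ev u t + (1 - c) * ev v t.
Proof.
have e0 : ev 0 t = 0.
  have := ev_lin 0 (a 0%N) (a 0%N) t; have := ev_lin (-1) (a 0%N) (a 0%N) t.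
  by rewrite scaleN1r addNr mulN1r addNr.
by rewrite ev_lin -[(1 - c) *: v]addr0 ev_lin e0 addr0.
Qed.

Lemma hull_le (A : set V) (P : T -> Prop) (d : R) u : hull A u ->
  (forall v, A v -> forall t, P t -> ev v t <= d) -> forall t, P t -> ev u t <= d.
Proof.
move=> hu Ad t Pt; elim: hu => [v /Ad->//|c v w c0 c1 _ hv _ hw].
rewrite ev_mix (_ : d = c * d + (1 - c) * d); last by rewrite -mulrDl addrC subrK mul1r.
by rewrite lerD// ler_wpM2l// subr_ge0.
Qed.

Lemma hull_ge0 k u t : hull (a @` [set i | (k <= i)%N]) u -> 0 <= ev u t.
Proof.
elim=> [_ [i _ <-]|c v w c0 c1 _ hv _ hw]; first by have [->|->] := a01 i t.
by rewrite ev_mix addr_ge0// mulr_ge0// subr_ge0.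
Qed.

Lemma hull_le1 k u t : hull (a @` [set i | (k <= i)%N]) u -> ev u t <= 1.
Proof.
move=> hu; apply: (hull_le (P := fun=> True) hu) => // _ [i _ <-] s _.
by have [->|->] := a01 i s.
Qed.

Lemma hull_support k u : hull (a @` [set i | (k <= i)%N]) u ->
  exists s : seq nat, (forall i, i \in s -> (k <= i)%N) /\
    forall t, ev u t != 0 -> exists2 i, i \in s & ev (a i) t = 1.
Proof.
elim=> [_ [i ki <-]|c v w c0 c1 _ [s [sk sP]] _ [s' [sk' sP']]].
  exists [:: i]; split=> [j|t]; first by rewrite inE => /eqP->.
  have [->|ait _] := a01 i t; first by rewrite eqxx.
  by exists i; rewrite ?inE.
exists (s ++ s'); split=> [i|t].
  by rewrite mem_cat => /orP[/sk|/sk'].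
rewrite ev_mix; have [v0|/sP[i si ai]] := eqVneq (ev v t) 0; last first.
  by exists i => //; rewrite mem_cat si.
have [w0|/sP'[i si ai]] := eqVneq (ev w t) 0.
  by rewrite v0 w0 !mulr0 addr0 eqxx.
by exists i => //; rewrite mem_cat si orbT.
Qed.

Definition through (tau : seq nat) : set T :=
  [set t | forall i, i \in tau -> ev (a i) t = 1].

(** Quantifying over all convex block sequences [v], not just [a], makes the property usable
    repeatedly: blocks of blocks are blocks of [a]. *)
Definition small_on (tau : seq nat) := forall v : nat -> V,
  (forall k, hull (a @` [set i | (k <= i)%N]) (v k)) ->
  forall (d : R) k, 0 < d ->
  exists2 u, hull (v @` [set i | (k <= i)%N]) u &
    forall t, through tau t -> ev u t <= d.

Lemma tail_mono (W : Type) (f : nat -> W) (k l : nat) : (k <= l)%N ->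
  f @` [set i | (l <= i)%N] `<=` f @` [set i | (k <= i)%N].
Proof. by move=> kl _ [i /= li <-]; exists i => //=; apply: leq_trans li. Qed.

(** The indices are handled one at a time: blocks already small for the rest of the list are
    combined again for [i], and convex combinations preserve smallness. *)
Lemma small_on_list tau (l : seq nat) v :
  (forall i, i \in l -> small_on (i :: tau)) ->
  (forall k, hull (a @` [set i | (k <= i)%N]) (v k)) ->
  forall (d : R) k, 0 < d ->
  exists2 u, hull (v @` [set i | (k <= i)%N]) u &
    forall i, i \in l -> forall t, through (i :: tau) t -> ev u t <= d.
Proof.
elim: l => [_ _ d k _|i l IH lP vP d k d0].
  by exists (v k) => //; apply: hull_in; exists k => //=.
have /choice[w wP] : forall k, exists w, hull (v @` [set i | (k <= i)%N]) w /\
    forall i, i \in l -> forall t, through (i :: tau) t -> ev w t <= d.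
  move=> j; have [|u hu uP] := IH _ vP d j d0; last by exists u.
  by move=> i' i'l; apply: lP; rewrite inE i'l orbT.
have hw j : hull (a @` [set i | (j <= i)%N]) (w j).
  have := (wP j).1; apply: hull_sub => _ [m /= jm <-].
  by apply: (hull_mono (tail_mono jm)); exact: vP.
have [u hu uP] := lP i (mem_head _ _) w hw d k d0.
exists u.
  apply: hull_sub hu => _ [m /= km <-].
  by apply: (hull_mono (tail_mono km)); exact: (wP m).1.
move=> i'; rewrite inE => /orP[/eqP->//|i'l] t tt.
apply: (hull_le (P := through (i' :: tau)) hu) => // _ [m _ <-].
exact: (wP m).2.
Qed.

(* Averaging r blocks, each small at the points met by an earlier block,
   gives at most (1 + r d) / (r + 1) on each point through tau. *)
Lemma small_on_step tau :
  (forall i, (forall j, j \in tau -> (j < i)%N) -> small_on (i :: tau)) ->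
  small_on tau.
Proof.
move=> tauP v vP d k d0.
(* Blocks supported beyond [tau] only involve extensions [i :: tau] by a larger [i], as the
   hypothesis demands. *)
pose K := maxn k (\max_(j <- tau) j.+1).
have Ktau i : (K <= i)%N -> forall j, j \in tau -> (j < i)%N.
  move=> Ki j jt; apply: leq_trans Ki; rewrite leq_max; apply/orP; right.
  exact: (@leq_bigmax_seq _ tau xpredT (fun j => j.+1)).
have vK : hull (v @` [set i | (K <= i)%N]) `<=` hull (a @` [set i | (K <= i)%N]).
  apply: hull_sub => _ [m /= Km <-].
  by apply: (hull_mono (tail_mono Km)); exact: vP.
have avg (r : nat) : exists2 u, hull (v @` [set i | (K <= i)%N]) u &
    forall t, through tau t -> r.+1%:R * ev u t <= 1 + r%:R * (d / 2).
  elim: r => [|r [u hu uP]].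
    exists (v K); first by apply: hull_in; exists K => //=.
    by move=> t _; rewrite mul1r mul0r addr0; apply: hull_le1 (vP K).
  have [s [sK sP]] := hull_support (vK _ hu).
  have d20 : 0 < d / 2 by rewrite divr_gt0.
  have [|w hw wP] := @small_on_list tau s v _ vP (d / 2) K d20.
    by move=> i si; apply: tauP; apply/Ktau/sK.
  pose c : R := r.+1%:R / r.+2%:R.
  have c1 : 1 - c = r.+2%:R^-1.
    by rewrite /c -(natr1 r.+1); field; rewrite nat1r natr1 pnatr_eq0.
  exists (c *: u + (1 - c) *: w).
    apply: hull_mix => //; first by rewrite divr_ge0.
    by rewrite -subr_ge0 c1 invr_ge0.
  move=> t tt; rewrite ev_mix.
  have -> : r.+2%:R * (c * ev u t + (1 - c) * ev w t) = r.+1%:R * ev u t + ev w t.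
    by rewrite c1 /c -(natr1 r.+1); field; rewrite nat1r natr1 pnatr_eq0.
  have [u0|u0] := eqVneq (ev u t) 0.
    rewrite u0 mulr0 add0r (le_trans (hull_le1 t (vK _ hw)))// lerDl.
    by rewrite mulr_ge0// ltW.
  have [i si ai] := sP t u0.
  rewrite -[X in 1 + X%:R * _]addn1 natrD mulrDl mul1r addrA lerD ?uP//.
  by apply: (wP i si) => j; rewrite inE => /orP[/eqP->//|/tt].
(* Then [r * (d / 2)] is at least 1, so [1 + r * (d / 2)] is at most [(r + 1) * d]. *)
pose r := Num.bound ((d / 2)^-1).
have [u hu uP] := avg r; exists u.
  by apply: hull_mono hu; apply: tail_mono; rewrite leq_maxl.
move=> t tt; have := uP t tt.
have rd : 1 <= r%:R * (d / 2).
  rewrite -ler_pdivrMr ?divr_gt0// div1r.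
  by apply/ltW/archi_boundP; rewrite invr_ge0 divr_ge0// ltW.
move=> h; have r0 : 0 < r.+1%:R :> R by [].
rewrite -(ler_pM2l r0) (le_trans h)//.
have -> : r.+1%:R * d = r%:R * (d / 2) + r%:R * (d / 2) + d.
  by rewrite -natr1; field.
by rewrite -addrA lerD// lerDl ltW.
Qed.

Hypothesis no_branch : forall i : nat -> nat,
  (forall k, (i k < i k.+1)%N) ->
  ~ forall k, exists t, forall l, (l < k)%N -> ev (a (i l)) t = 1.

(** By [small_on_step], failure at [tau] persists at some [i :: tau] with larger [i]. Iterating
    gives an infinite branch; each initial segment is realised by a point, since smallness on no
    points is trivial, against [no_branch]. *)
Lemma small_on_nil : small_on [::].
Proof.
apply: contrapT => N.
have /choice[next nextP] : forall x : {tau | ~ small_on tau}, exists i,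
    (forall j, j \in sval x -> (j < i)%N) /\ ~ small_on (i :: sval x).
  move=> [tau Ntau] /=; apply: contrapT => Ni; apply: Ntau.
  apply: small_on_step => i itau; apply: contrapT => Nit; apply: Ni.
  by exists i.
pose step (x : {tau | ~ small_on tau}) : {tau | ~ small_on tau} :=
  exist _ (next x :: sval x) (nextP x).2.
pose tau k := iter k step (exist _ [::] N).
have tauS k : sval (tau k.+1) = next (tau k) :: sval (tau k) by [].
apply: (@no_branch (fun k => next (tau k))) => [k|k].
  by apply: (nextP (tau k.+1)).1; rewrite tauS mem_head.
have [t tP] : exists t, through (sval (tau k)) t.
  apply: contrapT => Nt; apply: (svalP (tau k)) => v vP d m d0.
  exists (v m); first by apply: hull_in; exists m => //=.
  by move=> t tt; case: Nt; exists t.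
exists t => l lk; apply: tP; elim: k lk => // k IH.
rewrite ltnS leq_eqVlt tauS inE => /orP[/eqP->|/IH->]; first by rewrite eqxx.
by rewrite orbT.
Qed.

(** The lower bound [e] passes to convex combinations of the [a i], while some combination is
    uniformly too small for [phi] to reach [e]. *)
Lemma functional_null (phi : V -> R) (C e : R) :
  (forall c u v, phi (c *: u + v) = c * phi u + phi v) ->
  (forall u d, (forall t, `|ev u t| <= d) -> `|phi u| <= C * d) ->
  0 < e -> ~ forall i, e <= phi (a i).
Proof.
move=> phi_lin phiC e0 ea.
have phi0 : phi 0 = 0.
  have := phi_lin (-1) (a 0%N) (a 0%N).
  by rewrite scaleN1r addNr mulN1r addNr.
have hull_phi u : hull (a @` [set i | (0 <= i)%N]) u -> e <= phi u.
  elim=> [_ [i _ <-]//|c v w c0 c1 _ hv _ hw].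
  rewrite phi_lin -[(1 - c) *: w]addr0 phi_lin phi0 addr0.
  rewrite (_ : e = c * e + (1 - c) * e); last by rewrite -mulrDl addrC subrK mul1r.
  by rewrite lerD// ler_wpM2l// subr_ge0.
have d0 : 0 < e / (`|C| + 1) / 2 by rewrite !divr_gt0// ltr_wpDl.
have ha k : hull (a @` [set i | (k <= i)%N]) (a k).
  by apply: hull_in; exists k => //=.
have [u hu uP] := small_on_nil ha 0%N d0.
have := hull_phi _ hu; apply/negP; rewrite -ltNge.
apply: le_lt_trans (ler_norm _) _.
apply: le_lt_trans (phiC u (e / (`|C| + 1) / 2) _) _.
  by move=> t; rewrite ger0_norm ?(hull_ge0 t hu)//; apply: uP.
apply: (@le_lt_trans _ _ ((`|C| + 1) * (e / (`|C| + 1) / 2))).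
  rewrite ler_wpM2r// ?ltW//.
  by rewrite (lt_le_trans (_ : _ < `|C| + 1))// ltr_pwDr// ler_norm.
have C0 : `|C| + 1 != 0 by rewrite gt_eqF// ltr_wpDl.
by rewrite mulrA mulrCA mulfV// mulr1 ltr_pdivrMr// ltr_pMr// ltr1n.
Qed.

End ConvexCombinations.

(** * Closed spans of bounded functions *)

Section ClosedSpan.
Variables (T J : Type) (a : J -> T -> R).

Definition span_approx (f : T -> R) (e : R) := exists l : seq (R * J),
  forall t, `|f t - \sum_(p <- l) p.1 * a p.2 t| <= e.

Definition in_cspan (f : T -> R) := (exists C, forall t, `|f t| <= C) /\
  forall e : R, 0 < e -> span_approx f e.

Definition cspan_pred : {pred T -> R^o} := fun f => `[< in_cspan f >].

Lemma in_cspan0 : in_cspan (fun=> 0).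
Proof.
split; first by exists 0 => t; rewrite normr0.
by move=> e e0; exists [::] => t; rewrite big_nil subrr normr0 ltW.
Qed.

Lemma in_cspan_lin (c : R) f h :
  in_cspan f -> in_cspan h -> in_cspan (fun t => c * f t + h t).
Proof.
move=> [[C fC] fa] [[D hD] ha]; split.
  exists (`|c| * C + D) => t; rewrite (le_trans (ler_normD _ _))// lerD//.
  by rewrite normrM ler_wpM2l.
move=> e e0; have c0 : 0 < `|c| + 1 by rewrite ltr_wpDl.
have e1 : 0 < e / 2 / (`|c| + 1) by rewrite !divr_gt0.
have e2 : 0 < e / 2 by rewrite divr_gt0.
have [l lP] := fa _ e1; have [m mP] := ha _ e2.
exists ([seq (c * p.1, p.2) | p <- l] ++ m) => t.
rewrite big_cat big_map/=.
under eq_bigr do rewrite -mulrA.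
rewrite -mulr_sumr opprD addrACA -mulrBr (le_trans (ler_normD _ _))//.
rewrite [leRHS](splitr e) lerD// normrM.
apply: (@le_trans _ _ ((`|c| + 1) * (e / 2 / (`|c| + 1)))).
  by rewrite ler_pM// lerDl.
by rewrite mulrCA mulfV ?mulr1// gt_eqF.
Qed.

Lemma cspan_submod : submod_closed cspan_pred.
Proof.
split; first by apply/asboolP; exact: in_cspan0.
move=> c f h /asboolP cf /asboolP ch; apply/asboolP.
exact: in_cspan_lin.
Qed.

HB.instance Definition _ := GRing.isSubmodClosed.Build R (T -> R^o) cspan_pred cspan_submod.

(** The closed linear span of the [a j] in the bounded functions on [T], packaged as a type so that
    it can carry a Banach space structure. *)
Record cspan := CSpan { cspan_val : T -> R^o; _ : cspan_val \in cspan_pred }.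
HB.instance Definition _ := [isSub for cspan_val].
HB.instance Definition _ := [Choice of cspan by <:].
HB.instance Definition _ := [SubChoice_isSubLmodule of cspan by <:].


Lemma cspanP (u : cspan) : in_cspan (cspan_val u).
Proof. by case: u => f fP; apply/asboolP. Qed.

Definition cspan_of f (fP : in_cspan f) : cspan := @CSpan f (introT (asboolP _) fP).

Lemma cspan_ext (u v : cspan) : (forall t, cspan_val u t = cspan_val v t) -> u = v.
Proof. by move=> uv; apply: val_inj; apply/funext. Qed.

Lemma cspan_lin (c : R) (u v : cspan) t :
  cspan_val (c *: u + v) t = c * cspan_val u t + cspan_val v t.
Proof. by []. Qed.

Definition cspan_norm (u : cspan) : R := sup (range (fun t => `|cspan_val u t|)).

Lemma le_cspan_norm u t : `|cspan_val u t| <= cspan_norm u.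
Proof.
have [[C uC] _] := cspanP u; apply: ub_le_sup; last by exists t.
by exists C => _ [s _ <-].
Qed.

Lemma cspan_norm_le u (C : R) : 0 <= C -> (forall t, `|cspan_val u t| <= C) ->
  cspan_norm u <= C.
Proof.
move=> C0 uC; have [[t0 _]|/set0P/negP/negPn/eqP T0] := pselect ([set: T] !=set0).
  apply: ge_sup; first by exists `|cspan_val u t0|, t0.
  by move=> _ [t _ <-].
by rewrite /cspan_norm T0 image_set0 sup0.
Qed.

Lemma cspan_norm_ge0 u : 0 <= cspan_norm u.
Proof.
have [[t0 _]|/set0P/negP/negPn/eqP T0] := pselect ([set: T] !=set0).
  exact: le_trans (le_cspan_norm u t0).
by rewrite /cspan_norm T0 image_set0 sup0.
Qed.

Lemma cspan_normD u v : cspan_norm (u + v) <= cspan_norm u + cspan_norm v.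
Proof.
apply: cspan_norm_le => [|t]; first by rewrite addr_ge0 ?cspan_norm_ge0.
by rewrite (le_trans (ler_normD _ _))// lerD ?le_cspan_norm.
Qed.

Lemma cspan_normZ_le (c : R) u : cspan_norm (c *: u) <= `|c| * cspan_norm u.
Proof.
apply: cspan_norm_le => [|t]; first by rewrite mulr_ge0 ?cspan_norm_ge0.
by rewrite -[cspan_val _ t]/(c * cspan_val u t) normrM ler_wpM2l ?le_cspan_norm.
Qed.

Lemma cspan_normZ (c : R) u : cspan_norm (c *: u) = `|c| * cspan_norm u.
Proof.
have [->|c0] := eqVneq c 0.
  apply/eqP; rewrite normr0 mul0r eq_le cspan_norm_ge0 andbT.
  by rewrite (le_trans (cspan_normZ_le 0 u))// normr0 mul0r.
apply/eqP; rewrite eq_le cspan_normZ_le/=.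
rewrite -ler_pdivlMl ?normr_gt0// -normfV.
by have := cspan_normZ_le c^-1 (c *: u); rewrite scalerA mulVf// scale1r.
Qed.

Lemma cspan_norm0_eq0 u : cspan_norm u = 0 -> u = 0.
Proof.
move=> u0; apply: cspan_ext => t; apply/eqP; rewrite -normr_le0 -u0.
exact: le_cspan_norm.
Qed.

HB.instance Definition _ :=
  Lmodule_isNormed.Build R cspan cspan_normD cspan_normZ cspan_norm0_eq0.

Lemma cspan_complete (F : set_system cspan) : ProperFilter F -> cauchy F -> cvg F.
Proof.
move=> FF /cauchyP Fc.
have Fe (e : R) : 0 < e -> exists x : cspan, F [set y | `|x - y| < e].
  move=> e0; have [x Fx] := Fc e e0.
  by exists x; move: Fx; rewrite -ball_normE.
have [U [UU FU]] := ultraFilterLemma FF.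
have Ue (e : R) : 0 < e -> exists x : cspan, U [set y | forall t, `|cspan_val x t - cspan_val y t| < e].
  move=> /Fe[x /FU Ux]; exists x; apply: filterS Ux => y /= xy t.
  by apply: le_lt_trans xy; exact: (le_cspan_norm (x - y)).
have /choice[f fP] : forall t, exists l, ulim U (fun y : cspan => cspan_val y t) l.
  move=> t; have [x Ux] := Ue 1 ltr01.
  (* [bounded_ulim] wants a bound everywhere, but the values are bounded only on a set of [U];
     truncation repairs this. *)
  pose u (y : cspan) := if `[< `|cspan_val x t - cspan_val y t| < 1 >] then cspan_val y t else 0.
  have [|l lP] := @bounded_ulim _ U u (`|cspan_val x t| + 1) UU.
    move=> y; rewrite /u; case: asboolP => [xy|_]; last by rewrite normr0 addr_ge0.
    rewrite -lerBlDl (le_trans _ (ltW xy))// distrC.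
    exact: lerB_dist.
  exists l; apply: (ulim_near UU lP); apply: filterS Ux => y /= xy.
  by rewrite /u asboolT.
have fe (e : R) : 0 < e -> exists x : cspan,
    F [set y | `|x - y| < e] /\ forall t, `|f t - cspan_val x t| <= e.
  move=> e0; have [x Fx] := Fe e e0; exists x; split=> // t.
  apply: (ulim_le UU (ulim_norm UU (ulimB UU (fP t) (ulim_cst UU (cspan_val x t))))).
  apply: filterS (FU _ Fx) => y /= xy; rewrite distrC ltW//.
  by apply: le_lt_trans xy; exact: (le_cspan_norm (x - y)).
have fspan : in_cspan f.
  split.
    have [x [_ fx]] := fe 1 ltr01; have [[C xC] _] := cspanP x.
    exists (1 + C) => t; rewrite -[f t](subrK (cspan_val x t)).
    by rewrite (le_trans (ler_normD _ _))// lerD.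
  move=> e e0; have e2 : 0 < e / 2 by rewrite divr_gt0.
  have [x [_ fx]] := fe _ e2; have [_ /(_ _ e2)[l lP]] := cspanP x.
  exists l => t; rewrite (le_trans (ler_distD (cspan_val x t) _ _))//.
  by rewrite [leRHS](splitr e) lerD.
apply/cvg_ex; exists (cspan_of fspan); apply/cvgrPdist_le => /= e e0.
have e2 : 0 < e / 2 by rewrite divr_gt0.
have [x [Fx fx]] := fe _ e2.
near=> y; rewrite (le_trans (ler_distD x _ _))// [leRHS](splitr e) lerD//.
  by apply: cspan_norm_le => [|t]; [rewrite ltW|exact: fx].
by rewrite ltW//; near: y.
Unshelve. all: by end_near. Qed.

HB.instance Definition _ := Uniform_isComplete.Build cspan cspan_complete.

End ClosedSpan.

(** * Embedding X into a weakly compactly generated space *)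

Lemma finite_injection_contra (T : Type) (f : nat -> T) (A : set T) :
  injective f -> (forall n, A (f n)) -> finite_set A -> False.
Proof.
move=> fI fA /finite_preimage => /(_ _ f) h; apply: infinite_nat.
by apply: sub_finite_set (h _) => [n _|x y _ _]; [exact: fA|exact: fI].
Qed.

Section ClosedSpanMore.
Variables (T J : Type) (a : J -> T -> R).

Lemma cspan_sum (I : Type) (r : seq I) (F : I -> cspan a) t :
  cspan_val (\sum_(i <- r) F i) t = \sum_(i <- r) cspan_val (F i) t.
Proof. by elim/big_rec2: _ => // i y x _ <-. Qed.

Lemma in_cspan_gen p : (exists C, forall t, `|a p t| <= C) -> in_cspan a (a p).
Proof.
move=> pC; split=> // e e0; exists [:: (1, p)] => t.
by rewrite big_seq1 mul1r subrr normr0 ltW.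
Qed.

Lemma in_cspan_sum (K : Type) (l : seq (R * K)) (h : K -> T -> R) :
  (forall k, in_cspan a (h k)) -> in_cspan a (fun t => \sum_(p <- l) p.1 * h p.2 t).
Proof.
move=> hc; elim: l => [|[c k] l IH].
  by under eq_fun do rewrite big_nil; exact: in_cspan0.
by under eq_fun do rewrite big_cons; exact: in_cspan_lin.
Qed.

Lemma in_cspan_closed (f : T -> R) : (exists C, forall t, `|f t| <= C) ->
  (forall e : R, 0 < e -> exists2 h, in_cspan a h & forall t, `|f t - h t| <= e) ->
  in_cspan a f.
Proof.
move=> fC fh; split=> // e e0; have e2 : 0 < e / 2 by rewrite divr_gt0.
have [h [_ /(_ _ e2)[l lP]] hP] := fh _ e2; exists l => t.
by rewrite (le_trans (ler_distD (h t) _ _))// [leRHS](splitr e) lerD.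
Qed.

End ClosedSpanMore.

(** The member of a cover that contains 0 contains a weak neighbourhood given by finitely many
    functionals, hence all but finitely many [b p]. *)
Lemma null_family_weakly_compact (E : completeNormedModType R) (J : Type) (b : J -> E) :
  (forall f : E -> R, dual_on (fun x : E => `|x|) setT f -> forall e : R, 0 < e ->
     finite_set [set p | e <= `|f (b p)|]) ->
  weakly_compact_in (fun x : E => `|x|) setT ([set 0] `|` range b).
Proof.
move=> null; split=> // C Copen cover.
have [U0 CU0 U00] := cover 0 (or_introl erefl).
have [n [fs [Ffs [e [e0 eU]]]]] := Copen _ CU0 0 I U00.
pose bad := \bigcup_(i in [set: 'I_n]) [set p | e <= `|fs i (b p)|].
have fin : finite_set bad.
  by apply: bigcup_finite => // i _; apply: null.
have [s sE] := (@finite_seqP {classic J} _).1 fin.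
have /choice[U UP] : forall p, exists O, C O /\ O (b p).
  by move=> p; have [|O CO Ob] := cover (b p); [right; exists p|exists O].
exists (size s).+1, (fun i : 'I_(size s).+1 =>
  if unlift ord0 i is Some j then U (tnth (in_tuple s) j) else U0); split.
  by move=> i; case: unliftP => [j _|_]; [case: (UP (tnth (in_tuple s) j))|].
move=> _ [->|[p _ <-]]; first by exists ord0 => //; rewrite unlift_none.
have [bp|np] := pselect (bad p).
  move: bp; rewrite sE => ps; have : p \in in_tuple s := ps.
  move=> /tnthP[i ip].
  exists (lift ord0 i) => //; rewrite liftK -ip; exact: (UP p).2.
exists ord0 => //; rewrite unlift_none; apply: eU => // i.
have fs0 : fs i 0 = 0.
  have [lf _] := Ffs i; have := lf (-1) 0 0 I I.
  by rewrite scaler0 addr0 scaleN1r addNr.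
rewrite fs0 subr0 ltNge; apply/negP => ei; apply: np.
by exists i.
Qed.

Section Embedding.
Variables (G : Type) (S : set (set G)) (Sn : nat -> set (set G)).
Hypothesis qE : quasi_Eberlein S Sn.

Let SE := Eberleinization Sn.

(** Coordinate [g] on layer [n], extended by 0 to the disjoint union of the layers, whose points are
    coded as pairs. The closed span of these functions is the c_0-sum of the overview. *)
Definition gen (p : nat * G) (t : nat * set G) : R :=
  if `[< t.1 = p.1 /\ Sn p.1 t.2 >] then chi t.2 p.2 else 0.

Lemma gen01 p t : gen p t = 0 \/ gen p t = 1.
Proof. by rewrite /gen; case: asboolP => _; [exact: chi01|left]. Qed.

Lemma gen_le1 p t : `|gen p t| <= 1.
Proof. by have [->|->] := gen01 p t; rewrite ?normr0 ?normr1. Qed.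

Lemma gen_cspan p : in_cspan gen (gen p).
Proof. by apply: in_cspan_gen; exists 1 => t; exact: gen_le1. Qed.

Let E := cspan gen.
Definition genE p : E := cspan_of (gen_cspan p).

Lemma genE_norm p : `|genE p| <= 1.
Proof. by apply: cspan_norm_le => // t; exact: gen_le1. Qed.

(** Infinitely many such [g] would feed [functional_null]. A branch is impossible: sets of layer [n]
    containing ever more of its points would have a limit in the layer with infinitely many points
    of one colour. *)
Lemma functional_null_gen (col : G -> nat) n j (phi : E -> R) (e : R) :
  (forall x j, [set chi s | s in Sn n] x ->
     finite_set [set g | x g <> 0 /\ col g = j]) ->
  dual_on (fun x : E => `|x|) setT phi -> 0 < e ->
  finite_set [set g | col g = j /\ e <= phi (genE (n, g))].
Proof.
move=> colP [lin [C phiC]] e0; apply: contrapT => /infinite_injection[y [y_inj yP]].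
apply: (@functional_null E (nat * set G) (@cspan_val _ _ gen)
  (fun i => genE (n, y i)) _ _ _ phi `|C| e) => //.
- by move=> i t; exact: gen01.
- move=> i imono ik.
  have i_inj : injective (fun k => y (i k)).
    have im k l : (k < l)%N -> (i k < i l)%N.
      elim: l => // l IH; rewrite ltnS leq_eqVlt => /orP[/eqP->//|/IH kl].
      exact: ltn_trans (imono l).
    move=> k l /y_inj ikl; have [kl|lk|//] := ltngtP k l.
      by have := im _ _ kl; rewrite ikl ltnn.
    by have := im _ _ lk; rewrite ikl ltnn.
  have /choice[s sP] : forall k, exists s, Sn n s /\
      forall l, (l <= k)%N -> s (y (i l)).
    move=> k; have [[m s] sP] := ik k.+1.
    have gs l : (l <= k)%N -> m = n /\ Sn n s /\ s (y (i l)).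
      move=> lk; have := sP l lk.
      rewrite -[LHS]/(gen (n, y (i l)) (m, s)) /gen; case: asboolP => /= [[-> ns]|_].
        by move=> h; split=> //; split=> //; apply: chi_neq0; rewrite h; apply/eqP; exact: oner_neq0.
      by move=> /esym/eqP; rewrite oner_eq0.
    exists s; split=> [|l lk]; first by case: (gs 0%N) => // _ [].
    by case: (gs l lk) => _ [].
  have [U [UU Um]] := nat_ultra.
  have ls k : [set chi s | s in Sn n] (chi (s k)).
    by exists (s k) => //; case: (sP k).
  have [x lx xP] := Qlimit (Eberlein_ucompact (layer_Eberlein qE n)) UU ls.
  apply: (finite_injection_contra i_inj _ (colP x j lx)) => k; split; last first.
    by case: (yP (i k)).
  suff -> : x (y (i k)) = 1 by apply/eqP; exact: oner_neq0.
  apply: (ulim_uniq UU (xP _)); apply: (ulim_near UU (ulim_cst UU 1)).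
  apply: filterS (Um k) => l /= kl; rewrite chi_in//.
  exact: (sP l).2.
- by move=> c u v; exact: lin.
- move=> u d ud; apply: le_trans (phiC u I) _.
  have d0 : 0 <= d by exact: le_trans (ud (0%N, set0)).
  apply: le_trans (_ : `|C| * `|u| <= _); first by rewrite ler_wpM2r// ler_norm.
  by rewrite ler_wpM2l//; apply: cspan_norm_le.
- by move=> i; case: (yP i).
Qed.

Lemma cspan_WCG : WCG (cspan gen).
Proof.
have /choice[col colP] : forall n, exists col : G -> nat,
    forall x j, [set chi s | s in Sn n] x ->
    finite_set [set g | x g <> 0 /\ col g = j].
  move=> n; apply: Eberlein_colouring; first exact: layer_Eberlein qE n.
    by move=> x; exact: (layer_countable qE).
  by move=> x g; exact: layer01.
(* With these weights a functional can exceed [e] only for finitely many pairs of layer and colour,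
   and within each pair only at finitely many [g]. *)
pose w (p : nat * G) : R := (p.1.+1%:R * (col p.1 p.2).+1%:R)^-1.
have w0 p : 0 < w p by rewrite invr_gt0 mulr_gt0.
have w1 p : w p <= 1.
  by rewrite invf_le1 ?mulr_gt0// -natrM ler1n muln_gt0.
exists ([set 0] `|` range (fun p => w p *: genE p)); split.
  apply: null_family_weakly_compact => f df e e0.
  have [lf [C fC]] := df.
  have f0 : f 0 = 0.
    have := lf (-1) 0 0 I I; by rewrite scaler0 addr0 scaleN1r addNr.
  have fZ c u : f (c *: u) = c * f u.
    by rewrite -[c *: u]addr0 lf// f0 addr0.
  (* [functional_null_gen] is one-sided, so it is applied to [f] and to [- f]. *)
  have dN : dual_on (fun x : E => `|x|) setT (fun x => - f x).
    split=> [c x y _ _|]; first by rewrite lf// opprD scalerN.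
    by exists C => y _; rewrite normrN; apply: fC.
  have fg p : `|f (genE p)| <= `|C|.
    rewrite (le_trans (fC _ I))// (le_trans (_ : _ <= `|C| * `|genE p|))//.
      by rewrite ler_wpM2r// ler_norm.
    by rewrite ler_piMr// genE_norm.
  pose N := Num.bound (`|C| / e).
  have fin n j : finite_set [set g | col n g = j /\ e <= `|f (genE (n, g))|].
    have : finite_set ([set g | col n g = j /\ e <= f (genE (n, g))] `|`
        [set g | col n g = j /\ e <= - f (genE (n, g))]).
      rewrite finite_setU; split; first exact: (functional_null_gen j (@colP n) df e0).
      exact: (functional_null_gen j (@colP n) dN e0).
    apply: sub_finite_set => g [gj]; rewrite ler_normr => /orP[h|h].
      by left.
    by right.
  have : finite_set (\bigcup_(n in `I_N) \bigcup_(j in `I_N)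
      (pair n @` [set g | col n g = j /\ e <= `|f (genE (n, g))|])).
    apply: bigcup_finite => [|n _]; first exact: finite_II.
    apply: bigcup_finite => [|j _]; first exact: finite_II.
    exact: finite_image.
  apply: sub_finite_set => -[n g] /=; rewrite fZ normrM gtr0_norm// => he.
  have hC : (n.+1 * (col n g).+1)%:R <= `|C| / e.
    rewrite ler_pdivlMr// natrM -ler_pdivlMl ?mulr_gt0//.
    by rewrite (le_trans he)// ler_wpM2l// ltW.
  have hN : (n.+1 * (col n g).+1 <= N)%N.
    rewrite -(ler_nat R) (le_trans hC)// ltW// archi_boundP//.
    by rewrite divr_ge0// ltW.
  exists n; first by rewrite /= (leq_trans _ hN)// leq_pmulr.
  exists (col n g); first by rewrite /= (leq_trans _ hN)// leq_pmull.
  exists g => //; split=> //; rewrite (le_trans he)//.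
  by rewrite ler_piMl// w1.
move=> y _ e e0; have e2 : 0 < e / 2 by rewrite divr_gt0.
have [_ /(_ _ e2)[l lP]] := cspanP y.
exists (size l), (fun i => (tnth (in_tuple l) i).1 / w (tnth (in_tuple l) i).2).
exists (fun i => w (tnth (in_tuple l) i).2 *: genE (tnth (in_tuple l) i).2); split.
  by move=> i; right; exists (tnth (in_tuple l) i).2.
apply: (@le_lt_trans _ _ (e / 2)); last by rewrite ltr_pdivrMr// ltr_pMr// ltr1n.
apply: cspan_norm_le => [|t]; first exact: ltW.
have := lP t; congr (`|_| <= _).
rewrite -[RHS]/(cspan_val y t - cspan_val _ t) cspan_sum; congr (_ - _).
rewrite big_tnth; apply: eq_bigr => i _.
rewrite scalerA mulrVK ?unitfE ?gt_eqF// ?lt0r_neq0//.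
Qed.

(** The pullback of [f] along the map from the disjoint union of the layers onto [SE]. *)
Definition raw (f : FS G) (t : nat * set G) : R :=
  if `[< Sn t.1 t.2 >] then f (fun g => t.1.+1%:R^-1 * chi t.2 g) else 0.

(** On layer [n] this is [gen (n, g)] divided by [n.+1], so cutting off the layers from [N] on costs
    at most [1/(N+1)]. *)
Lemma raw_coord_cspan g : in_cspan gen (raw (fun x => x g)).
Proof.
have small n (s : set G) : `|n.+1%:R^-1 * chi s g : R| <= n.+1%:R^-1.
  rewrite normrM ger0_norm ?invr_ge0// ler_piMr ?invr_ge0//.
  by have [->|->] := chi01 s g; rewrite ?normr0 ?normr1.
apply: in_cspan_closed.
  exists 1 => -[n s]; rewrite /raw /=; case: asboolP => _; last by rewrite normr0.
  by rewrite (le_trans (small n s))// invf_le1// ler1n.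
move=> e e0; pose N := Num.bound e^-1.
exists (fun t => \sum_(p <- [seq (n.+1%:R^-1, (n, g)) | n <- index_iota 0 N]) p.1 * gen p.2 t).
  by apply: in_cspan_sum => p; exact: gen_cspan.
move=> [n s]; rewrite big_map /raw /=.
have [nN|Nn] := ltnP n N.
  rewrite (bigD1_seq n) ?mem_index_iota ?iota_uniq//= big1 => [|i ni].
    rewrite addr0 /gen /=; case: asboolP => ns; case: asboolP => h.
    - by rewrite subrr normr0 ltW.
    - by case: h.
    - by case: h => _ /ns.
    - by rewrite mulr0 subrr normr0 ltW.
  rewrite /gen /= asboolF ?mulr0// => -[ni' _].
  by move: ni; rewrite ni' eqxx.
rewrite big_seq big1 => [|i]; last first.
  rewrite mem_index_iota => /andP[_ iN]; rewrite /gen /= asboolF ?mulr0// => -[ni' _].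
  by move: iN; rewrite -ni' ltnNge Nn.
rewrite subr0; case: asboolP => _; last by rewrite normr0 ltW.
rewrite (le_trans (small n s))// invf_ple ?posrE//.
apply: le_trans (ltW (archi_boundP _)) _; first by rewrite invr_ge0 ltW.
by rewrite ler_nat (leq_trans Nn).
Qed.

Lemma raw_le f t : Xspace SE f -> `|raw f t| <= supnorm SE f.
Proof.
move=> Xf; have h x : SE x -> `|f x| <= supnorm SE f.
  exact: (X_le_supnorm (SE_ucompact qE)).
rewrite /raw; case: asboolP => [st|_]; first by apply: h; exact: SEP.
by rewrite normr0; apply: le_trans (h _ (SE0 qE)).
Qed.

Lemma raw_cspan f : Xspace SE f -> in_cspan gen (raw f).
Proof.
move=> Xf; apply: in_cspan_closed.
  by exists (supnorm SE f) => t; exact: raw_le.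
move=> e e0.
have [l lP] := X_approx (SE_ucompact qE) (@SE_bound G Sn) Xf e0.
exists (fun t => \sum_(p <- l) p.1 * raw (fun x => x p.2) t).
  exact: (in_cspan_sum l raw_coord_cspan).
move=> [n s]; rewrite /raw /=; case: asboolP => ns.
  by apply: lP; exact: SEP.
by rewrite big1 ?subrr ?normr0 ?ltW// => p _; rewrite mulr0.
Qed.

Definition embed (f : FS G) : cspan gen :=
  match pselect (in_cspan gen (raw f)) with
  | left fP => cspan_of fP
  | right _ => 0
  end.

Lemma embed_val f t : in_cspan gen (raw f) -> cspan_val (embed f) t = raw f t.
Proof. by move=> fP; rewrite /embed; case: pselect. Qed.

Lemma embedE f t : Xspace SE f -> cspan_val (embed f) t = raw f t.
Proof. by move=> /raw_cspan; exact: embed_val. Qed.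

Lemma embed_lin : lin_on (Xspace SE) embed.
Proof.
move=> c f h Xf Xh; apply: cspan_ext => t.
rewrite cspan_lin (embedE t Xf) (embedE t Xh).
have rawE : raw (c *: f + h) = (fun t => c * raw f t + raw h t).
  apply/funext => s; rewrite /raw; case: asboolP => // _.
  by rewrite mulr0 addr0.
by rewrite embed_val rawE//; apply: in_cspan_lin; exact: raw_cspan.
Qed.

(** The coded pairs run through all of [SE], so both suprema see the same values of [f]; the
    remaining pairs contribute only 0. *)
Lemma embed_norm f : Xspace SE f -> `|embed f| = supnorm SE f.
Proof.
move=> Xf; apply/eqP; rewrite eq_le; apply/andP; split.
  apply: cspan_norm_le => [|t]; last by rewrite embedE//; exact: raw_le.
  exact: le_trans (normr_ge0 _) (raw_le (0%N, set0) Xf).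
apply: (supnorm_le (SE_neq0 qE)) => _ [n [s [ns ->]]].
have := le_cspan_norm (embed f) (n, s); rewrite embedE// /raw /=.
by rewrite asboolT.
Qed.

End Embedding.

Theorem theorem3p6 (G : Type) (S : set (set G)) (Sn : nat -> set (set G)) :
  quasi_Eberlein S Sn ->
  let SE := Eberleinization Sn in
  let X := Xspace SE in
  (exists (E : completeNormedModType R) (T : FS G -> E),
      WCG E /\ lin_on X T /\ forall f, X f -> `|T f| = supnorm SE f) /\
  ~ WCG_in (supnorm SE) X.
Proof.
move=> qE; split; last exact: (not_WCG qE).
exists (cspan (gen Sn)), (@embed G Sn); split; first exact: (cspan_WCG qE).
split; first exact: (embed_lin qE).
by move=> f; exact: (embed_norm qE).
Qed.
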